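(* Let $d\ge1$, $a,r\in[0,1]$, $\omega\ge0$ with $\omega\in L^1(\mathbb{R}^d)\cap L^\infty(\mathbb{R}^d)$, and let $(\phi_t)_{t\ge0}$ be a global Lagrangian solution (with $\phi_0$ a probability density in $L^\infty$) of $$\partial_t\phi_t=\operatorname{div}\bigl(\phi_t(K_a*\omega-K_r*\phi_t)\bigr)$$ for which the energy dissipation identity $$\frac{d}{dt}\mathcal{E}(\phi_t)=-\int_{\mathbb{R}^d}|K_a*\omega-K_r*\phi_t|^2\,d\phi_t$$ is valid. Assume $\inf\mathcal{E}>-\infty$ and that there exists an exponent $q>\max\{a,r\}$ such that $$\sup_{t\ge0}\int_{\mathbb{R}^d}|x|^q\,d\phi_t(x)<\infty,\qquad\int_{\mathbb{R}^d}|x|^q\omega(x)\,dx<\infty .$$ Then there exist a sequence $t_k\to\infty$ and a probability measure $\phi_\infty$ such that $\phi_{t_k}\rightharpoonup\phi_\infty$ narrowly, and $\phi_\infty$ is a zero-flux stationary state: $$\phi_\infty\bigl(K_a*\omega-K_r*\phi_\infty\bigr)=0$$ in the sense of vector-valued distributions. Moreover, for every $0<\delta<q$, the convergence $\int f\,d\phi_{t_k}\to\int f\,d\phi_\infty$ holds for every continuous $f$ satisfying $|f(x)|\le C_f(1+|x|^{q-\delta})$.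
   Context: For $s\in[0,1]$: $\psi_s(x)=|x|^{1+s}$, $K_s(x)=\nabla\psi_s(x)=(1+s)|x|^{s-1}x$ for $x\ne0$, $K_s(0)=0$. Energy: $$\mathcal{E}(\phi)=\int(\psi_a*\omega)\,d\phi-\frac12\iint\psi_r(x-y)\,d\phi(x)\,d\phi(y),$$ and $\inf\mathcal{E}$ is the infimum over probability measures (for which $\mathcal{E}$ is defined). Lagrangian solution: $\phi_t=(X_t)_\#\phi_0$ with $\dot X_t(x)=-(K_a*\omega)(X_t(x))+(K_r*\phi_t)(X_t(x))$, $X_0(x)=x$, for $\phi_0$-a.e. $x$; $\phi$ is nonnegative and lies in $L^\infty(0,T;L^1\cap L^\infty)$ for every $T>0$. Zero-flux: $\int\xi(x)\cdot(K_a*\omega(x)-K_r*\phi_\infty(x))\,d\phi_\infty(x)=0$ for all $\xi\in C_c^\infty(\mathbb{R}^d;\mathbb{R}^d)$. Narrow convergence is convergence against bounded continuous functions. *)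

(* Defs.v *)
From HB Require Import structures.
From mathcomp Require Import all_boot all_order all_algebra.
From mathcomp Require Import all_classical all_reals all_analysis.
From mathcomp Require Import measurable_realfun.

Set Implicit Arguments.
Unset Strict Implicit.
Unset Printing Implicit Defensive.

Import Order.TTheory GRing.Theory Num.Theory.
Import numFieldNormedType.Exports.

Local Open Scope classical_set_scope.
Local Open Scope ring_scope.

HB.instance Definition _ (R : realType) (m n : nat) :=
  @isMeasurable.Build (sigma_display (@open 'M[R]_(m, n))) 'M[R]_(m, n)
    <<s @open 'M[R]_(m, n) >>
    (@sigma_algebra0 _ setT _) (@sigma_algebraC _ _)
    (@sigma_algebra_bigcup _ setT _).

Section borel_matrix.
Context {R : realType}.

Lemma measurable_mx_open m n (U : set 'M[R]_(m, n)) : open U -> measurable U.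
Proof. by move=> oU; exact: sub_sigma_algebra. Qed.

Lemma measurable_mx_coord m n i j :
  measurable_fun setT (fun M : 'M[R]_(m, n) => M i j).
Proof.
apply: (measurability _ (RGenOpens.measurableE R)).
move=> _ [_ [a [b ->] <-]]; rewrite setTI; apply: measurable_mx_open.
apply: open_comp => [x _|]; first exact: coord_continuous.
exact: interval_open.
Qed.

Lemma mx_open_bigcup_ball m n (U : set 'M[R]_(m, n)) : open U ->
  U = \bigcup_(p in [set p : 'M[rat]_(m, n) * nat |
    ball (map_mx ratr p.1 : 'M[R]_(m, n)) p.2.+1%:R^-1 `<=` U])
    ball (map_mx ratr p.1 : 'M[R]_(m, n)) p.2.+1%:R^-1.
Proof.
move=> oU; apply/seteqP; split=> [M UM|M [p pU]]; last exact: pU.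
have /nbhs_ballP[e /= e0 eU] : nbhs M U by exact: open_nbhs_nbhs.
have [k ke] : exists k : nat, k.+1%:R^-1 < e / 2.
  have e2 : 0 < e / 2 by rewrite divr_gt0.
  near \oo => k; exists k.
  near: k; exact: near_infty_natSinv_lt (PosNum e2).
have k0 : (0 : R) < k.+1%:R^-1 by rewrite invr_gt0.
have near_rat i j : exists q : rat, ball (M i j) k.+1%:R^-1 (ratr q).
  have [] := @dense_rat R (ball (M i j) k.+1%:R^-1).
  - by exists (M i j); exact: ballxx.
  - exact: ball_open.
  - by move=> _ [] /[swap] -[q _ <-] ?; exists q.
pose Q : 'M[rat]_(m, n) := \matrix_(i, j) projT1 (cid (near_rat i j)).
have MQ : ball M k.+1%:R^-1 (map_mx ratr Q : 'M[R]_(m, n)).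
  by split => // i j; rewrite !mxE; case: cid.
exists (Q, k) => /=; last exact: ball_sym.
move=> N QN; apply: eU; rewrite (splitr e).
apply: (ball_triangle (y := (map_mx ratr Q : 'M[R]_(m, n)))).
  exact: le_ball (ltW ke) _ MQ.
exact: le_ball (ltW ke) _ QN.
Unshelve. all: by end_near. Qed.

Lemma measurable_fun_mx d (T : measurableType d) (D : set T) m n
    (f : T -> 'M[R]_(m, n)) :
  (forall i j, measurable_fun D (fun x => f x i j)) -> measurable_fun D f.
Proof.
move=> mf mD; apply: (@measurability _ _ _ _ D f (@open 'M[R]_(m, n))) => //.
move=> _ [U oU <-]; rewrite (mx_open_bigcup_ball oU) preimage_bigcup setI_bigcupr.
rewrite bigcup_mkcond.
apply: countable_bigcupT_measurable => [|p]; first exact: countableP.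
case: ifPn => // _.
set M := map_mx _ _; set e := _^-1.
rewrite (_ : _ `&` _ = \bigcap_(ij in [set: 'I_m * 'I_n])
    (D `&` (fun x => f x ij.1 ij.2) @^-1` ball (M ij.1 ij.2) e) `&` D); last first.
  apply/seteqP; split => x.
    by move=> [Dx [e0 Mf]]; split => // -[i j] _; split => //=; exact: Mf.
  move=> [Mf Dx]; split => //; split => [|i j]; first by rewrite invr_gt0.
  by have [] := Mf (i, j) I.
apply: measurableI => //; apply: fin_bigcap_measurable.
  exact: finite_finset.
by move=> ij _; apply: mf => //; apply: open_measurable; exact: ball_open.
Qed.

End borel_matrix.

Lemma sigma_finite_product d1 d2 (T1 : measurableType d1)
    (T2 : measurableType d2) (R : realType)
    (m1 : {sigma_finite_measure set T1 -> \bar R})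
    (m2 : {sigma_finite_measure set T2 -> \bar R}) :
  sigma_finite setT (m1 \x m2)%E.
Proof.
have /sigma_finiteP[F [TF ndF Foo]] := sigma_finiteT m1.
have /sigma_finiteP[G [TG ndG Goo]] := sigma_finiteT m2.
exists (fun n => F n `*` G n).
  rewrite -setXTT TF TG predeqE => -[x y]; split.
    move=> [/= [n _ Fnx] [k _ Gky]]; exists (maxn n k) => //; split.
    - by move: x Fnx; exact/subsetPset/ndF/leq_maxl.
    - by move: y Gky; exact/subsetPset/ndG/leq_maxr.
  by move=> [n _ []/= ? ?]; split; exists n.
move=> k; have [? ?] := Foo k; have [? ?] := Goo k.
split; first exact: measurableX.
by rewrite product_measure1E// lte_mul_pinfty// ge0_fin_numE.
Qed.

Section lebesgue_rV.
Context {R : realType}.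
Local Open Scope ereal_scope.

Definition cons_rV n (p : measurableTypeR R * 'rV[R]_n) : 'rV[R]_n.+1 :=
  row_mx (const_mx p.1 : 'M[R]_1) p.2.

Definition uncons_rV n (v : 'rV[R]_n.+1) : measurableTypeR R * 'rV[R]_n :=
  (v 0%R ord0, \row_i v 0%R (lift ord0 i)).

Lemma cons_rV0 n (p : measurableTypeR R * 'rV[R]_n) : cons_rV p 0%R ord0 = p.1.
Proof.
rewrite /cons_rV mxE; case: splitP => [j _|k /= /eqP//]; first by rewrite mxE.
Qed.

Lemma cons_rVS n (p : measurableTypeR R * 'rV[R]_n) i :
  cons_rV p 0%R (lift ord0 i) = p.2 0%R i.
Proof.
rewrite /cons_rV mxE; case: splitP => [[[]//]|k /= [ik]].
by congr (_ _ _); apply: ord_inj.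
Qed.

Lemma cons_rVK n : cancel (@cons_rV n) (@uncons_rV n).
Proof.
move=> [x v]; rewrite /uncons_rV cons_rV0; congr pair.
by apply/rowP => i; rewrite mxE cons_rVS.
Qed.

Lemma measurable_uncons_rV n : measurable_fun setT (@uncons_rV n).
Proof.
apply/measurable_fun_pairP; split; first exact: measurable_mx_coord.
apply: measurable_fun_mx => i j.
rewrite (_ : (fun _ => _) = fun v : 'rV[R]_n.+1 => v 0%R (lift ord0 j)).
  exact: measurable_mx_coord.
by apply/funext => v; rewrite /uncons_rV /= mxE.
Qed.

Lemma measurable_cons_rV n : measurable_fun setT (@cons_rV n).
Proof.
apply: measurable_fun_mx => i j; rewrite ord1.
case: (unliftP ord0 j) => [k ->|->].
  under eq_fun do rewrite cons_rVS.
  exact: measurableT_comp (measurable_mx_coord _ _) measurable_snd.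
under eq_fun do rewrite cons_rV0.
exact: measurable_fst.
Qed.

Definition lebesgue_cons n (mu : {sigma_finite_measure set 'rV[R]_n -> \bar R})
    : set 'rV[R]_n.+1 -> \bar R :=
  pushforward (@lebesgue_measure R \x mu) (@cons_rV n).

Section lebesgue_cons.
Variables (n : nat) (mu : {sigma_finite_measure set 'rV[R]_n -> \bar R}).

Let lebesgue_cons0 : lebesgue_cons mu set0 = 0.
Proof. by rewrite /lebesgue_cons /pushforward preimage_set0 measure0. Qed.

Let lebesgue_cons_ge0 A : 0 <= lebesgue_cons mu A.
Proof. exact: (measure_ge0 (@lebesgue_measure R \x mu)). Qed.

Let lebesgue_cons_sigma_additive : semi_sigma_additive (lebesgue_cons mu).
Proof.
have mcons := @measurable_cons_rV n.
move=> F mF tF mUF; rewrite /lebesgue_cons /pushforward preimage_bigcup.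
apply: measure_semi_sigma_additive.
- by move=> k; rewrite -[X in measurable X]setTI; exact: mcons.
- apply/trivIsetP => /= i j _ _ ij; rewrite -preimage_setI.
  by move/trivIsetP : tF => /(_ _ _ _ _ ij) ->//; rewrite preimage_set0.
- by rewrite -preimage_bigcup -[X in measurable X]setTI; exact: mcons.
Qed.

HB.instance Definition _ := isMeasure.Build _ _ _ (lebesgue_cons mu)
  lebesgue_cons0 lebesgue_cons_ge0 lebesgue_cons_sigma_additive.

Let lebesgue_cons_sigma_finite : sigma_finite setT (lebesgue_cons mu).
Proof.
have [F FT mF] := sigma_finite_product (@lebesgue_measure R) mu.
exists (fun k => @uncons_rV n @^-1` F k).
  by rewrite -preimage_bigcup -FT preimage_setT.
move=> k; have [mFk Fk] := mF k; split.
  by rewrite -[X in measurable X]setTI; exact: measurable_uncons_rV.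
rewrite /lebesgue_cons /pushforward -comp_preimage.
rewrite (_ : _ \o _ = id) ?preimage_id//.
by apply/funext => p /=; rewrite cons_rVK.
Qed.

HB.instance Definition _ := Measure_isSigmaFinite.Build _ _ _ (lebesgue_cons mu)
  lebesgue_cons_sigma_finite.

End lebesgue_cons.

(* Iterated product of the one-dimensional Lebesgue measure; lebesgue_rV_box
   below gives its value on boxes. *)
Fixpoint lebesgue_rV n : {sigma_finite_measure set 'rV[R]_n -> \bar R} :=
  match n with
  | 0 => \d_(0%R : 'rV[R]_0)
  | n.+1 => lebesgue_cons (lebesgue_rV n)
  end.

Lemma lebesgue_rV_box n (a b : 'rV[R]_n) : (forall i, (a 0 i <= b 0 i)%R) ->
  lebesgue_rV n [set x : 'rV[R]_n | forall i, (a 0 i < x 0 i <= b 0 i)%R] =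
  \prod_i (b 0%R i - a 0%R i)%:E.
Proof.
elim: n a b => [|n IHn] a b ab /=.
  by rewrite big_ord0 diracE mem_set// => -[].
rewrite big_ord_recl /lebesgue_cons /pushforward.
rewrite (_ : _ @^-1` _ = `]a 0%R ord0, b 0%R ord0] `*`
    [set x : 'rV[R]_n | forall i,
      ((\row_i a 0 (lift ord0 i)) 0 i < x 0 i <=
       (\row_i b 0 (lift ord0 i)) 0 i)%R]); last first.
  apply/seteqP; split => -[x v] /=.
    move=> abx; split => [|i]; last by rewrite !mxE -(cons_rVS (x, v)); exact: abx.
    by rewrite in_itv /=; have := abx ord0; rewrite cons_rV0.
  rewrite in_itv /= => -[abx abv] i.
  case: (unliftP ord0 i) => [k ->|->]; last by rewrite cons_rV0.
  by have := abv k; rewrite cons_rVS !mxE.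
rewrite product_measure1E//=.
- rewrite lebesgue_measure_itv/= lte_fin IHn => [|i]; last by rewrite !mxE.
  congr (_ * _); last by apply: eq_bigr => i _; rewrite !mxE.
  case: (ltgtP (a 0%R ord0) (b 0%R ord0)) (ab ord0) => // -> _.
  by rewrite subrr.
- set al := \row__ _; set bl := \row__ _.
  rewrite (_ : [set _ | _] = \bigcap_(i in [set: 'I_n])
      (fun x : 'rV[R]_n => x 0%R i) @^-1` `]al 0%R i, bl 0%R i]); last first.
    apply/seteqP; split => x /= xab i; first by move=> _ /=; rewrite in_itv/=; exact: xab.
    by have := xab i I; rewrite /= in_itv.
  apply: fin_bigcap_measurable; first exact: finite_finset.
  move=> i _; rewrite -[X in measurable X]setTI.
  exact: measurable_mx_coord.
Qed.

End lebesgue_rV.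

(* The norm of the normed module 'rV[R]_d is the sup norm, hence a separate
   Euclidean norm; both induce the same topology. *)
Section euclidean.
Context {R : realType} {d : nat}.

Definition dotv (x y : 'rV[R]_d) : R := \sum_i x 0 i * y 0 i.

Definition enorm (x : 'rV[R]_d) : R := Num.sqrt (dotv x x).

End euclidean.

Section interaction_energy.
Context {R : realType} {d : nat}.
Implicit Types (s a r t : R) (x y : 'rV[R]_d) (omega : 'rV[R]_d -> R).
Local Notation leb := (@lebesgue_rV R d).

Definition psi s x : R := enorm x `^ (1 + s).

Definition kernelK s x : 'rV[R]_d :=
  if x == 0 then 0 else ((1 + s) * enorm x `^ (s - 1)) *: x.

(* [omega] stands for the measure omega dx. *)
Definition psi_conv a omega x : \bar R :=
  (\int[leb]_y (psi a (x - y) * omega y)%:E)%E.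

Definition kernel_conv_density a omega x : 'rV[R]_d :=
  \row_i \int[leb]_y (kernelK a (x - y) 0 i * omega y).

Definition kernel_conv r (mu : probability 'rV[R]_d R) x : 'rV[R]_d :=
  \row_i \int[mu]_y (kernelK r (x - y) 0 i).

Definition drift a r omega (mu : probability 'rV[R]_d R) x : 'rV[R]_d :=
  kernel_conv_density a omega x - kernel_conv r mu x.

Definition attraction a omega (mu : probability 'rV[R]_d R) : \bar R :=
  (\int[mu]_x psi_conv a omega x)%E.

Definition repulsion r (mu : probability 'rV[R]_d R) : \bar R :=
  ((2^-1)%:E * \int[mu \x mu]_z (psi r (z.1 - z.2))%:E)%E.

Definition energy a r omega mu : \bar R :=
  (attraction a omega mu - repulsion r mu)%E.

(* Both terms are integrals of nonnegative functions, so the energy is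
   undefined exactly when it reads +oo - +oo. *)
Definition energy_defined a r omega mu : Prop :=
  (attraction a omega mu +? - repulsion r mu)%E.

Definition inf_energy a r omega : \bar R :=
  ereal_inf [set energy a r omega mu | mu in energy_defined a r omega].

Definition dissipation a r omega (mu : probability 'rV[R]_d R) : \bar R :=
  (\int[mu]_x (enorm (drift a r omega mu x) ^+ 2)%:E)%E.

(* The last equation forces the dissipation to be finite. *)
Definition energy_dissipation a r omega (phi : R -> probability 'rV[R]_d R) :=
  forall t, 0 < t ->
  [/\ energy a r omega (phi t) \is a fin_num,
      derivable (fun u => fine (energy a r omega (phi u))) t 1 &
      ((derive1 (fun u => fine (energy a r omega (phi u))) t)%:E =
        - dissipation a r omega (phi t))%E].

Definition has_density (mu : probability 'rV[R]_d R) (f : 'rV[R]_d -> R) :=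
  [/\ measurable_fun setT f, {ae leb, forall x, 0 <= f x} &
      forall A, measurable A -> mu A = (\int[leb]_(x in A) (f x)%:E)%E].

(* rho lies in L^oo(0, T; L^1 `&` L^oo) for every T > 0; as for weakly-*
   measurable curves, only joint measurability in (t, x) is asked. *)
Definition locally_bounded_density (phi : R -> probability 'rV[R]_d R) :=
  exists rho : R -> 'rV[R]_d -> R,
  [/\ forall t, 0 <= t -> has_density (phi t) (rho t),
      measurable_fun [set p : R * 'rV[R]_d | 0 < p.1] (fun p => rho p.1 p.2) &
      forall T, 0 < T -> exists M : R,
        {ae lebesgue_measure, forall t : R, 0 < t < T ->
          ('N[leb]_1[EFin \o rho t] <= M%:E)%E /\
          ('N[leb]_(+oo)[EFin \o rho t] <= M%:E)%E}].

Definition lagrangian_solution a r omega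
    (phi : R -> probability 'rV[R]_d R) :=
  locally_bounded_density phi /\
  exists X : R -> 'rV[R]_d -> 'rV[R]_d,
  [/\ forall t, 0 <= t -> measurable_fun setT (X t),
      forall t, 0 <= t -> forall A, measurable A ->
        phi t A = pushforward (phi 0) (X t) A &
      {ae phi 0, forall x,
        [/\ X 0 x = x,
            {within [set t | 0 <= t], continuous (fun t => X t x)} &
            forall t, 0 < t ->
              is_derive t 1 (fun u => X u x)
                (- kernel_conv_density a omega (X t x) +
                 kernel_conv r (phi t) (X t x))]}].

(* C^k maps, through continuity of the iterated partial derivatives. *)
Fixpoint Ck k (f : 'rV[R]_d -> 'rV[R]_d) : Prop :=
  match k with
  | 0 => continuous f
  | k.+1 => continuous f /\ forall i : 'I_d,
      (forall x, derivable f x (delta_mx 0 i)) /\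
      Ck k (fun x => 'D_(delta_mx 0 i) f x)
  end.

Definition test_field (xi : 'rV[R]_d -> 'rV[R]_d) :=
  (forall k, Ck k xi) /\ compact (closure [set x | xi x != 0]).

Definition zero_flux a r omega (mu : probability 'rV[R]_d R) :=
  forall xi, test_field xi ->
  (\int[mu]_x (dotv (xi x) (drift a r omega mu x))%:E = 0)%E.

Definition integral_cvg (mu_ : nat -> probability 'rV[R]_d R)
    (mu : probability 'rV[R]_d R) (f : 'rV[R]_d -> R) :=
  [/\ forall k, (mu_ k).-integrable setT (EFin \o f),
      mu.-integrable setT (EFin \o f) &
      \int[mu_ k]_x f x @[k --> \oo] --> \int[mu]_x f x].

Definition narrow_cvg (mu_ : nat -> probability 'rV[R]_d R)
    (mu : probability 'rV[R]_d R) :=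
  forall f : 'rV[R]_d -> R, continuous f -> bounded_fun f ->
  integral_cvg mu_ mu f.

End interaction_energy.

(* Main.v *)
(* The energy decreases at the rate given by the dissipation and is bounded
   below, so the dissipation vanishes along some times t_k -> oo. The moment
   bound makes the laws at these times tight, and a subsequence converges to
   some phioo; the moment of order q > max(a, r) upgrades the convergence to
   all continuous functions, of one or two variables, negligible with respect
   to 1 + |x|^q. For a test field xi, the flux of a law mu is
     int xi . (K_a * omega) dmu
       - 1/2 int int (xi x - xi y) . K_r (x - y) dmu(x) dmu(y),
   the second term being symmetrized because K_r is odd. Both integrands are
   continuous, even for exponent 0 (the first because omega dx has no atom, the
   second because xi x - xi y vanishes on the diagonal), so the flux passes to
   the limit; by AM-GM it is controlled by the dissipation and tends to 0.

   For compactness, a point is encoded by the sequence of bits "x_i < q" over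
   coordinates i and rationals q. A cluster point of the laws of finite words
   of bits is realized by random bits on [0, 1[, whose decoding is almost
   surely well defined by tightness; its law is the limit. *)
From HB Require Import structures.
Require Import Defs.
From mathcomp Require Import all_boot all_order all_algebra.
From mathcomp Require Import all_classical all_reals all_analysis.
From mathcomp Require Import measurable_realfun.
From mathcomp Require Import ring lra.
Set Implicit Arguments.
Unset Strict Implicit.
Unset Printing Implicit Defensive.
Import Order.TTheory GRing.Theory Num.Theory.
Import numFieldNormedType.Exports.
Local Open Scope classical_set_scope.
Local Open Scope ring_scope.

(** * Random words of bits *)

Section words.
Context {T : Type} (b : nat -> T -> bool).

(* The most recent bit comes first. *)
Fixpoint word n x : seq bool := if n is n'.+1 then b n' x :: word n' x else [::].

Definition cell (w : seq bool) : set T := [set x | word (size w) x = w].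

Lemma size_word n x : size (word n x) = n.
Proof. by elim: n => //= n ->. Qed.

Lemma cell_word n x : cell (word n x) x.
Proof. by rewrite /cell /= size_word. Qed.

Lemma cell_cons c w : cell (c :: w) = cell w `&` [set x | b (size w) x = c].
Proof. by apply/seteqP; split => x /=; [case=> <- wx; split|case=> + <-; rewrite /cell /= => ->].
Qed.

End words.

Lemma word_bit T T' (b : nat -> T -> bool) (b' : nat -> T' -> bool) j n x y :
  (j < n)%N -> word b n x = word b' n y -> b j x = b' j y.
Proof. by elim: n => //= n IH; rewrite ltnS leq_eqVlt => /orP[/eqP ->|/IH jn] [] // ? /jn. Qed.

Section measurable_words.
Context d (T : measurableType d) (b : nat -> T -> bool).
Hypothesis mb : forall n, measurable [set x | b n x].

Lemma measurable_cell w : measurable (cell b w).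
Proof.
elim: w => [|c w IH].
  by rewrite (_ : cell b [::] = setT) //; apply/seteqP; split.
rewrite cell_cons; apply: measurableI => //; case: c; first exact: mb.
rewrite (_ : [set x | _] = ~` [set x | b (size w) x]); first exact: measurableC.
by apply/seteqP; split => x /=; [move=> ->|move=> /negP/negbTE].
Qed.

(** Words form a countable type, so [S] can be arbitrary. *)
Lemma measurable_word_preimage n (S : set (seq bool)) :
  measurable [set x | S (word b n x)].
Proof.
rewrite (_ : [set x | _] = \bigcup_(w in S `&` [set w | size w = n]) cell b w).
  rewrite bigcup_mkcond; apply: countable_bigcupT_measurable => [|w].
    exact: countableP.
  by case: ifPn => // _; exact: measurable_cell.
apply/seteqP; split => x /=; last by case=> w [Sw /= <-]; rewrite /cell /= => ->.
by move=> Sx; exists (word b n x); [split=> //=; rewrite size_word|exact: cell_word].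
Qed.

Lemma measure_cell_cons {R : realType} (P : {measure set T -> \bar R}) w :
  P (cell b w) = (P (cell b (true :: w)) + P (cell b (false :: w)))%E.
Proof.
rewrite -measureU; first last.
- apply/seteqP; split => // x [] /=; rewrite !cell_cons => -[_ /= ->] [_ /=].
  by [].
- exact: measurable_cell.
- exact: measurable_cell.
congr (P _); rewrite !cell_cons; apply/seteqP; split => x /=.
  by move=> wx; case: (b (size w) x); [left|right].
by case=> -[].
Qed.

Local Open Scope ereal_scope.

(** The integrand is constant on each product of two cells of length [n]. The double integral is
    thus a polynomial in the cell probabilities and passes to the limit with them. *)
Lemma integral_words {R : realType} (P : probability T R) n
    (g : seq bool -> seq bool -> R) : (forall v w, 0 <= g v w)%R ->
  \int[P \x P]_z (g (word b n z.1) (word b n z.2))%:E =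
  (\sum_(v : n.-tuple bool) \sum_(w : n.-tuple bool)
     g v w * (fine (P (cell b v)) * fine (P (cell b w))))%:E.
Proof.
move=> g0.
have ind v w : measurable_fun setT
    (fun z : T * T => (g v w * \1_(cell b v `*` cell b w) z)%:E).
  apply/measurable_EFinP; apply: measurable_funM => //.
  by apply: measurable_indic; apply: measurableX; exact: measurable_cell.
rewrite (eq_integral (fun z => \sum_(v : n.-tuple bool) \sum_(w : n.-tuple bool)
    (g v w * \1_(cell b v `*` cell b w) z)%:E)); last first.
  move=> z _.
  have sz y : size (word b n y) == n by rewrite size_word.
  pose t y : n.-tuple bool := Tuple (sz y).
  have tP y (v : n.-tuple bool) : cell b v y -> v = t y.
    by rewrite /cell /= size_tuple => yv; apply: val_inj.
  rewrite (bigD1 (t z.1)) //= (bigD1 (t z.2)) //=.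
  rewrite !big1 ?adde0 /=.
  - rewrite indicE mem_set ?mulr1 //; split; exact: cell_word.
  - move=> v vz; rewrite big1 // => w _; rewrite indicE memNset ?mulr0//.
    by case=> /= /tP zv; rewrite zv eqxx in vz.
  - move=> v vz; rewrite indicE memNset ?mulr0//.
    by case=> /= _ /tP zv; rewrite zv eqxx in vz.
have ge0 v w z : 0 <= (g v w * \1_(cell b v `*` cell b w) z)%:E.
  by rewrite lee_fin mulr_ge0 // indicE.
rewrite ge0_integral_sum //=; last first.
- by move=> v z _; apply: sume_ge0.
- by move=> v; apply: emeasurable_sum => w.
rewrite -sumEFin; apply: eq_bigr => v _.
rewrite ge0_integral_sum //= -sumEFin; apply: eq_bigr => w _.
under eq_integral do rewrite EFinM.
rewrite (@ge0_integralZl _ _ _ (P \x P) setT measurableT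
    (fun z => (\1_(cell b v `*` cell b w) z)%:E)) ?lee_fin //; last first.
  apply/measurable_EFinP; apply: measurable_indic; apply: measurableX; exact: measurable_cell.
rewrite integral_indic ?setIT //; last by apply: measurableX; exact: measurable_cell.
transitivity ((g v w)%:E * (P (cell b v) * P (cell b w))).
  by congr (_ * _); apply: product_measure1E; exact: measurable_cell.
by rewrite 2!EFinM !fineK // fin_num_measure //; exact: measurable_cell.
Qed.

End measurable_words.

(** * Realization of consistent word probabilities on the unit interval *)

Section random_bits.
Context {R : realType} (alpha : seq bool -> R).
Hypothesis alpha0 : forall w, 0 <= alpha w.
Hypothesis alpha_nil : alpha [::] = 1.
Hypothesis alpha_cons : forall w, alpha w = alpha (true :: w) + alpha (false :: w).

Let P : probability (measurableTypeR R) R := uniform_prob (@ltr01 R).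

(* The words of each length cut [0, 1[ into consecutive intervals
   `[left_end w, left_end w + alpha w[. *)
Fixpoint left_end (w : seq bool) : R :=
  match w with
  | [::] => 0
  | true :: w => left_end w
  | false :: w => left_end w + alpha (true :: w)
  end.

Let split_point w := left_end w + alpha (true :: w).

(** The recursion builds words rather than bits: the bit added to a word tells on which side of the
    split point of its interval [u] lies. [word_random_bit] identifies [code] with the words of
    [random_bit]. *)
Fixpoint code n (u : measurableTypeR R) : seq bool :=
  if n is n'.+1 then (u < split_point (code n' u)) :: code n' u else [::].

Definition random_bit n (u : measurableTypeR R) := u < split_point (code n u).

Lemma word_random_bit n u : word random_bit n u = code n u.
Proof. by elim: n => //= n ->. Qed.

(** Induction on the word: by [alpha_cons], the split point cuts the interval of [w] into pieces of
    lengths [alpha (true :: w)] and [alpha (false :: w)]. *)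
Lemma cell_random_bit w : cell random_bit w `&` `[0, 1[%classic =
  `[left_end w, left_end w + alpha w[%classic.
Proof.
elim: w => [|c w IH]; apply/seteqP; split => u /=.
- by rewrite add0r alpha_nil => -[].
- by rewrite add0r alpha_nil.
- rewrite cell_cons => -[[wu /= cu]] u01.
  have : (cell random_bit w `&` `[0, 1[%classic) u by [].
  rewrite IH /= !in_itv /= => /andP[lu ul].
  move: cu; rewrite /random_bit -word_random_bit wu /split_point; case: c => /= [->|].
    by rewrite lu.
  by move/negbT; rewrite -leNgt => ->; rewrite /= -addrA -alpha_cons.
- rewrite in_itv /= => /andP[lu ul].
  have : `[left_end w, left_end w + alpha w[%classic u.
    rewrite /= in_itv /=; case: c lu ul => lu ul.
      rewrite lu (lt_le_trans ul) // lerD2l (alpha_cons w) lerDl; exact: alpha0.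
    rewrite -addrA -alpha_cons in ul; rewrite ul andbT.
    by apply: le_trans lu; rewrite lerDl.
  rewrite -IH => -[wu u01]; split => //; rewrite cell_cons; split => //=.
  rewrite /random_bit -word_random_bit wu /split_point; case: c lu ul => // lu _.
  by rewrite ltNge lu.
Qed.

Lemma measurable_random_bit n : measurable [set u | random_bit n u].
Proof.
suff mcode w : measurable [set u | code n u = w].
  rewrite (_ : [set u | _] =
    \bigcup_w ([set u | code n u = w] `&` `]-oo, split_point w[%classic)).
    apply: countable_bigcupT_measurable => [|w]; first exact: countableP.
    exact: measurableI.
  apply/seteqP; split => u /=.
    by move=> ub; exists (code n u) => //; split => //=; rewrite in_itv.
  by move=> [w _ [<-]] /=; rewrite in_itv.
elim: n w => [|n IH] [|c w] /=.
- by rewrite (_ : [set u | _] = setT) //; apply/seteqP; split.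
- by rewrite (_ : [set u | _] = set0) //; apply/seteqP; split.
- by rewrite (_ : [set u | _] = set0) //; apply/seteqP; split.
- rewrite (_ : [set u | _] = [set u | code n u = w] `&`
      (if c then `]-oo, split_point w[%classic else ~` `]-oo, split_point w[%classic)).
    by apply: measurableI => //; case: c => //; exact: measurableC.
  apply/seteqP; split => u /=.
    by move=> [<- <-]; split => //; case: ifPn; rewrite /= in_itv /= ?negbK // => /negP.
  by move=> [->]; case: c => /=; rewrite in_itv /=; [move=> ->|move=> /negP/negbTE ->].
Qed.

Lemma random_bit_cell w : P (cell random_bit w) = (alpha w)%:E.
Proof.
have mc := measurable_cell measurable_random_bit w.
rewrite /P /= /uniform_prob integral_uniform_pdf.
(* The uniform law is carried by the closed interval; the endpoint 1 is split off as a null set. *)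
have -> : cell random_bit w `&` `[0, 1]%classic =
    (cell random_bit w `&` `[0, 1[%classic) `|` (cell random_bit w `&` [set 1]).
  by rewrite -setIUr setUitv1 //= bnd_simp.
rewrite (eq_integral (fun=> 1%E)); last first.
  move=> x; rewrite inE => -[[_ x01]|[_ ->]].
    rewrite /uniform_pdf ifT ?subr0 ?invr1//.
    by move: x01; rewrite /= !in_itv /= => /andP[-> /ltW ->].
  by rewrite /uniform_pdf ifT ?subr0 ?invr1// lexx ler01.
rewrite integral_cst /= ?mul1e; last first.
  by apply: measurableU; apply: measurableI.
rewrite cell_random_bit measureU0 //=.
- rewrite lebesgue_measure_itv /= lte_fin ltrDl lt_def alpha0 andbT.
  by case: eqP => [->|_] //=; rewrite -EFinD addrAC subrr add0r.
- exact: measurableI.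
- apply/eqP; rewrite -measure_le0 -(@lebesgue_measure_set1 R 1).
  by apply: le_measure; rewrite ?inE//; exact: measurableI.
Qed.

End random_bits.

(** Tychonoff's theorem gives a cluster point in the product of the segments; since [I] is
    countable, a diagonal choice of indices converges to it. The bound [k <= n_ k] is all that
    limits at infinity require of the indices. *)
Lemma pointwise_subsequence {R : realType} (I : countType) (p : nat -> I -> R) :
  (forall k i, 0 <= p k i <= 1) ->
  exists (n_ : nat -> nat) (alpha : I -> R), (forall k, (k <= n_ k)%N) /\
    forall i, p (n_ k) i @[k --> \oo] --> alpha i.
Proof.
move=> p01.
have /= cpt := @tychonoff I (fun=> R) (fun=> `[0, 1]%classic) (fun=> @segment_compact R 0 1).
have [|al [_ clal]] := cpt (p @ \oo) _.
  by exists 0%N => // k _ i; rewrite /= in_itv /=; exact: p01.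
(* Shrinking neighbourhoods of [al]: the coordinates numbered below [k] are controlled up to
   [1 / (k + 1)]. *)
pose near_al k := [set f : I -> R |
  forall i, (pickle i < k)%N -> `|al i - f i| < k.+1%:R^-1].
have /= ex_near k : exists n, (k <= n)%N /\ near_al k (p n).
  have [] := clal [set p n | n in [set n | (k <= n)%N]] (near_al k).
  - by exists k => // n /= kn; exists n.
  - have near1 (j : nat) : nbhs al [set f |
        forall i : I, unpickle j = Some i -> `|al i - f i| < k.+1%:R^-1].
      case: (unpickle j) => [i|]; last exact: filterS filterT.
      have := @proj_continuous I (fun=> R) i.
      move=> /(_ al (ball (al i) k.+1%:R^-1)) /= []; first exact: nbhsx_ballx.
      move=> U [oU alU UB]; exists U; split => // f /UB fU _ [<-]; exact: fU.
    have : forall m, nbhs al [set f |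
        forall i : I, (pickle i < m)%N -> `|al i - f i| < k.+1%:R^-1].
      elim=> [|m IH]; first by apply: filterS filterT.
      move: (near1 m); apply: filterS2 IH => f fm f1 i.
      by rewrite ltnS leq_eqVlt => /orP[/eqP im|/fm//]; apply: f1; rewrite -im pickleK.
    exact.
  - by move=> f [[n kn <-] pn]; exists n.
have [n_ n_P] := choice ex_near.
exists n_, al; split => [k|i]; first by have [] := n_P k.
apply/cvgrPdist_lt => e e0.
near=> k.
have [_ /(_ i) nk] := n_P k.
apply: lt_trans (nk _) _; first by near: k; exists (pickle i).+1.
by near: k; exact: near_infty_natSinv_lt (PosNum e0).
Unshelve. all: by end_near. Qed.

(** * Encoding points by half-spaces *)

Lemma continuous_measurable_rV {R : realType} n (f : 'rV[R]_n -> R) :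
  continuous f -> measurable_fun setT f.
Proof.
move=> cf; apply: (measurability _ (RGenOpens.measurableE R)).
move=> _ [_ [a [b ->] <-]]; rewrite setTI; apply: measurable_mx_open.
by apply: open_comp => [x _|]; [exact: cf|exact: interval_open].
Qed.

(** The function factors through row vectors of length [n + n], where continuity gives Borel
    measurability; the concatenation is measurable for the product sigma-algebra, coordinate by
    coordinate. *)
Lemma continuous_measurable_rV2 {R : realType} n (f : 'rV[R]_n * 'rV[R]_n -> R) :
  continuous f -> measurable_fun setT f.
Proof.
move=> cf.
rewrite (_ : f = (fun v : 'rV[R]_(n + n) => f (lsubmx v, rsubmx v)) \o
    (fun p => row_mx p.1 p.2)); last first.
  by apply/funext => -[x y] /=; rewrite row_mxKl row_mxKr.
apply: measurableT_comp.
  apply: continuous_measurable_rV => v.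
  apply: (@continuous_comp _ _ _ (fun w : 'rV[R]_(n + n) => (lsubmx w, rsubmx w)));
    last exact: cf.
  exact: (cvg_pair (@continuous_lsubmx R 1 n n v) (@continuous_rsubmx R 1 n n v)).
apply: measurable_fun_mx => i j; rewrite -[j]splitK.
case: (fintype.split j) => k /=.
  under eq_fun do rewrite row_mxEl.
  exact: measurableT_comp (measurable_mx_coord _ _) measurable_fst.
under eq_fun do rewrite row_mxEr.
exact: measurableT_comp (measurable_mx_coord _ _) measurable_snd.
Qed.

Section decoding.
Context {R : realType} {d : nat}.

(** Through [pickle], the index enumerates the pairs of a coordinate and a rational; an index that
    codes no pair carries the constant bit [true]. *)
Definition halfspace n (x : 'rV[R]_d) : bool :=
  if (unpickle n : option ('I_d * rat)) is Some (i, q) then x 0 i < ratr q else true.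

Lemma halfspaceE i (q : rat) x : halfspace (pickle (i, q)) x = (x 0 i < ratr q).
Proof. by rewrite /halfspace pickleK. Qed.

Lemma measurable_halfspace n : measurable [set x | halfspace n x].
Proof.
rewrite /halfspace; case: (unpickle n) => [[i q]|]; last first.
  by rewrite (_ : [set x | _] = setT) //; apply/seteqP; split.
rewrite (_ : [set x | _] = (fun x : 'rV[R]_d => x 0 i) @^-1` `]-oo, ratr q[%classic).
  rewrite -[X in measurable X]setTI; exact: measurable_mx_coord.
by apply/seteqP; split => x /=; rewrite in_itv.
Qed.

(* The bits c n claim the truth value of halfspace n at the decoded point. *)
Definition threshold (c : nat -> bool) (i : 'I_d) n : \bar R :=
  if (unpickle n : option ('I_d * rat)) is Some (j, q) then
    if (j == i) && c n then (ratr q)%:E else +oo%E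
  else +oo%E.

(** [einfs _ 0] is the infimum of the whole sequence: coordinate [i] is the infimum of the rationals
    [q] for which [x_i < q] is claimed, [+oo] standing for the absence of a claim. *)
Definition decode (c : nat -> bool) : 'rV[R]_d :=
  \row_i fine (einfs (threshold c i) 0).

Lemma measurable_decode (dT : measure_display) (U : measurableType dT) (b : nat -> U -> bool) :
  (forall n, measurable [set u | b n u]) ->
  measurable_fun setT (fun u => decode (b ^~ u)).
Proof.
move=> mb; apply: measurable_fun_mx => i j; under eq_fun do rewrite mxE.
apply: (measurableT_comp (fine_measurable measurableT)).
apply: measurable_fun_einfs => n; rewrite /threshold.
case: (unpickle n) => [[k q]|]; last exact: measurable_cst.
case: (k == j) => /=; last exact: measurable_cst.
apply: measurable_fun_ifT; [|exact: measurable_cst|exact: measurable_cst].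
by apply: (measurable_fun_bool true); rewrite setTI; exact: mb.
Qed.

Variables (T : Type) (b : nat -> T -> bool) (u : T).

(** Each finite prefix comes from an actual point. The full sequence need not, for instance when
    these points approach a rational bound from below. *)
Definition consistent := forall n, exists x, word halfspace n x = word b n u.
Definition bounded_bits := forall i : 'I_d, exists p q : rat,
  ~~ b (pickle (i, p)) u /\ b (pickle (i, q)) u.

(** A point sharing a long prefix with [u] has its coordinate at least [p] and below a given claimed
    rational, so [p] bounds the claimed rationals from below. The claim at [q] bounds their infimum
    from above. *)
Lemma threshold_finite i : consistent -> bounded_bits ->
  einfs (threshold (b ^~ u) i) 0 \is a fin_num.
Proof.
move=> cu /(_ i) [p [q [bp bq]]].
rewrite fin_numElt; apply/andP; split.
  apply: (@lt_le_trans _ _ (ratr p)%:E); first exact: ltNyr.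
  apply: le_ereal_inf_tmp => _ [n _ <-]; rewrite /threshold.
  case nE : (unpickle n) => [[j q']|]; last by rewrite leey.
  case: ifPn => [/andP[/eqP ji bn]|]; last by rewrite leey.
  have [x xu] := cu (maxn n (pickle (i, p))).+1.
  rewrite lee_fin; apply: (@le_trans _ _ (x 0 i)).
    have : halfspace (pickle (i, p)) x = b (pickle (i, p)) u.
      by apply: word_bit xu; rewrite ltnS leq_maxr.
    by rewrite (negbTE bp) halfspaceE => /negbT; rewrite -leNgt.
  have : halfspace n x = b n u by apply: word_bit xu; rewrite ltnS leq_maxl.
  by rewrite bn /halfspace nE ji => /ltW.
apply: (@le_lt_trans _ _ (ratr q)%:E); last exact: ltry.
apply: ereal_inf_lbound; exists (pickle (i, q)) => //=.
by rewrite /threshold pickleK eqxx bq.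
Qed.

(** Two bits per coordinate suffice: some [p] within [e] below the decoded value is not claimed and
    some [q] less than [e] above it is, so points with these bits satisfy [p <= x_i < q]. The bits
    of the decoded point itself may differ from those of [u]. *)
Lemma nbhs_decode (U : set 'rV[R]_d) : consistent -> bounded_bits ->
  nbhs (decode (b ^~ u)) U ->
  \forall n \near \oo, forall x, word halfspace n x = word b n u -> U x.
Proof.
move=> cu bu /nbhs_ballP[e /= e0 eU].
suff coord (i : 'I_d) : \forall n \near \oo, forall x, word halfspace n x = word b n u ->
    `|decode (b ^~ u) 0 i - x 0 i| < e.
  have := @filter_forall _ _ (fun i n => forall x, word halfspace n x = word b n u ->
    `|decode (b ^~ u) 0 i - x 0 i| < e) \oo eventually_filter coord.
  apply: filterS => n near_n x xu; apply: eU; split => // i j; rewrite (ord1 i); exact: near_n.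
have fi := threshold_finite i cu bu.
pose s := fine (einfs (threshold (b ^~ u) i) 0).
have sE : s%:E = einfs (threshold (b ^~ u) i) 0 by rewrite fineK.
rewrite mxE -/s.
have [p] : exists p : rat, s - e < ratr p < s.
  have [] := @rat_in_itvoo R (s - e) s; first by rewrite ltrBlDr ltrDl.
  by move=> p; rewrite in_itv /=; exists p.
move=> /andP[ep ps].
have bp : ~~ b (pickle (i, p)) u.
  apply/negP => bp; suff : (s%:E <= (ratr p)%:E)%E by rewrite lee_fin leNgt ps.
  rewrite sE; apply: ereal_inf_lbound; exists (pickle (i, p)) => //=.
  by rewrite /threshold pickleK eqxx bp.
have [n2 [q [n2E bn2 qe]]] : exists n q, [/\ unpickle n = Some (i, q), b n u & ratr q < s + e].
  have : (einfs (threshold (b ^~ u) i) 0%N < (s + e)%:E)%E by rewrite -sE lte_fin ltrDl.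
  move=> /ereal_inf_lt[_ [n _ <-]]; rewrite /threshold.
  case nE : (unpickle n) => [[j q]|//]; case: ifPn => // /andP[/eqP ji bn].
  by rewrite lte_fin => qe; exists n, q; rewrite nE ji.
exists (maxn (pickle (i, p)) n2).+1 => // n /= nlt x xu.
have : halfspace (pickle (i, p)) x = b (pickle (i, p)) u.
  by apply: word_bit xu; apply: leq_trans nlt; rewrite ltnS leq_maxl.
rewrite (negbTE bp) halfspaceE => /negbT; rewrite -leNgt => px.
have : halfspace n2 x = b n2 u.
  by apply: word_bit xu; apply: leq_trans nlt; rewrite ltnS leq_maxr.
rewrite bn2 /halfspace n2E => xq.
by rewrite ltr_distl; apply/andP; split; lra.
Qed.

End decoding.

(** * Compactness of tight sequences *)

Lemma limn_einf_ereal_sup {R : realType} (u : (\bar R)^nat) :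
  limn_einf u = ereal_sup (range (einfs u)).
Proof. by rewrite limn_einf_lim; apply: cvg_lim => //; exact: cvg_einfs_sup. Qed.

Lemma lt_limn_einf {R : realType} (u : (\bar R)^nat) (c : \bar R) :
  (c < limn_einf u)%E -> exists n, (c < u n)%E.
Proof.
rewrite limn_einf_ereal_sup => /ereal_sup_gt[_ [n _ <-]] cu.
by exists n; apply: lt_le_trans cu _; apply: ereal_inf_lbound; exists n => /=.
Qed.

Lemma le_limn_einf_near {R : realType} (u : (\bar R)^nat) (c : \bar R) :
  (\forall n \near \oo, c <= u n)%E -> (c <= limn_einf u)%E.
Proof.
move=> [N _ cu]; rewrite limn_einf_ereal_sup.
apply: (@le_trans _ _ (einfs u N)); last by apply: ereal_sup_ubound; exists N.
by apply: le_ereal_inf_tmp => _ [n /= Nn <-]; exact: cu.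
Qed.

(** By Tonelli's theorem, the change of variables is made once in each variable. Single integrals
    are recovered from functions of the first variable. *)
Lemma pushforward_prod {R : realType} d1 d2 (T1 : measurableType d1) (T2 : measurableType d2)
    (P : probability T1 R) (X : T1 -> T2) : measurable_fun setT X ->
  exists mu : probability T2 R, forall f : T2 * T2 -> \bar R,
    measurable_fun setT f -> (forall z, 0 <= f z)%E ->
    (\int[mu \x mu]_z f z = \int[P \x P]_z f (X z.1, X z.2))%E.
Proof.
move=> mX.
pose X' : {mfun T1 >-> T2} := HB.pack X (isMeasurableFun.Build _ _ _ _ X mX).
exists (distribution P X') => f mf f0.
have mfX : measurable_fun setT (fun z : T1 * T1 => f (X z.1, X z.2)).
  apply: (measurableT_comp mf); apply: measurable_fun_pair.
    exact: measurableT_comp measurable_fst.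
  exact: measurableT_comp measurable_snd.
rewrite fubini_tonelli1 // [RHS]fubini_tonelli1 //.
rewrite /fubini_F ge0_integral_distribution.
- apply: eq_integral => x _ /=; rewrite ge0_integral_distribution //.
  exact: measurableT_comp.
- exact: measurable_fun_fubini_tonelli_F.
- by move=> y; exact: integral_ge0.
Qed.

Lemma negligible_fst {R : realType} d1 d2 (T1 : measurableType d1) (T2 : measurableType d2)
    (P : probability T1 R) (Q : probability T2 R) A :
  P.-negligible A -> (P \x Q)%E.-negligible (fst @^-1` A).
Proof.
move=> [B [mB PB AB]]; exists (B `*` setT); split; first exact: measurableX.
  transitivity (P B * Q setT)%E; last by rewrite PB mul0e.
  exact: product_measure1E.
by move=> z /= /AB.
Qed.

Lemma negligible_snd {R : realType} d1 d2 (T1 : measurableType d1) (T2 : measurableType d2)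
    (P : probability T1 R) (Q : probability T2 R) A :
  Q.-negligible A -> (P \x Q)%E.-negligible (snd @^-1` A).
Proof.
move=> [B [mB QB AB]]; exists (setT `*` B); split; first exact: measurableX.
  transitivity (P setT * Q B)%E; last by rewrite QB mule0.
  exact: product_measure1E.
by move=> z /= /AB.
Qed.

(** * The law of the decoded random bits and its lower semicontinuity *)

Section limit_law.
Context {R : realType} {d : nat}.
Variables (mu_ : nat -> probability 'rV[R]_d R) (alpha : seq bool -> R).
Hypothesis mu_cvg : forall w,
  fine (mu_ k (cell (@halfspace R d) w)) @[k --> \oo] --> alpha w.

Local Notation hs := (@halfspace R d).
Local Notation mhs := (@measurable_halfspace R d).

Let alpha0 w : 0 <= alpha w.
Proof.
by apply: (cvgr_to_ge (@mu_cvg w)); apply: nearW => k; rewrite fine_ge0.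
Qed.

Let alpha_nil : alpha [::] = 1.
Proof.
have := @mu_cvg [::]; rewrite (_ : (fun _ => _) = cst 1).
  by move=> /cvg_lim <- //; rewrite lim_cst.
apply/funext => k; rewrite (_ : cell _ [::] = setT) ?probability_setT//.
by apply/seteqP; split.
Qed.

Let alpha_cons w : alpha w = alpha (true :: w) + alpha (false :: w).
Proof.
apply: (@cvg_unique _ (@Rhausdorff R) _ _ _ _ (@mu_cvg w)).
apply: cvg_trans (cvgD (@mu_cvg (true :: w)) (@mu_cvg (false :: w))).
apply: near_eq_cvg; apply: nearW => k /=.
apply/esym; rewrite (measure_cell_cons mhs) fineD //.
  by apply: fin_num_measure; exact: measurable_cell mhs _.
by apply: fin_num_measure; exact: measurable_cell mhs _.
Qed.

Let P : probability (measurableTypeR R) R := uniform_prob (@ltr01 R).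
Let bit := random_bit alpha.
Let mbit : forall n, measurable [set u | bit n u] := measurable_random_bit alpha.
Let Pcell : forall w, P (cell bit w) = (alpha w)%:E :=
  random_bit_cell alpha0 alpha_nil alpha_cons.

(** By [integral_words], both sides are the same finite combination of products of cell
    probabilities, whose limits are the values of [alpha]. *)
Lemma integral_words_cvg n (g : seq bool -> seq bool -> R) :
  (forall v w, 0 <= g v w) ->
  fine (\int[mu_ k \x mu_ k]_z (g (word hs n z.1) (word hs n z.2))%:E)%E @[k --> \oo] -->
  fine (\int[P \x P]_z (g (word bit n z.1) (word bit n z.2))%:E)%E.
Proof.
move=> g0; rewrite (integral_words mbit P n g0) /=.
under eq_fun do rewrite (integral_words mhs) //=.
apply: (@cvg_big _ _ _ 0) => // [|v _]; first exact: add_continuous.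
apply: (@cvg_big _ _ _ 0) => // [|w _]; first exact: add_continuous.
apply: cvgMr.
by rewrite !Pcell /=; apply: cvgM; exact: mu_cvg.
Qed.

Lemma random_bit_le n c (e : R) :
  (forall k, mu_ k [set x | hs n x = c] <= e%:E)%E -> (P [set u | bit n u = c] <= e%:E)%E.
Proof.
move=> le_e.
(* The most recent bit heads the word, so on words of length [n + 1] this function tests bit [n] of
   the first variable. *)
pose g (v w : seq bool) : R := if v is b :: _ then (b == c)%:R else 0.
have g0 v w : 0 <= g v w by case: v => //=.
have gE d' (T : measurableType d') (b : nat -> T -> bool) (Q : probability T R) :
    (forall n, measurable [set x | b n x]) ->
    (\int[Q \x Q]_z (g (word b n.+1 z.1) (word b n.+1 z.2))%:E = Q [set x | b n x = c])%E.
  move=> mb.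
  have mc : measurable [set x | b n x = c].
    rewrite (_ : [set x | _] = [set x | (fun w => head false w = c) (word b n.+1 x)]) //.
    exact: (measurable_word_preimage mb n.+1 (fun w => head false w = c)).
  rewrite (eq_integral (fun z => (\1_([set x | b n x = c] `*` setT) z)%:E)).
    rewrite integral_indic ?setIT//; last exact: measurableX.
    transitivity (Q [set x | b n x = c] * Q setT)%E; last by rewrite probability_setT mule1.
    exact: product_measure1E.
  move=> z _ /=; rewrite indicE /=; congr ((nat_of_bool _)%:R%:E); apply/idP/idP.
    by move=> /eqP bz; apply/mem_set.
  by rewrite inE => -[/= -> _]; rewrite eqxx.
have := @integral_words_cvg n.+1 g g0.
rewrite gE // => cv.
rewrite -[X in (X <= _)%E]fineK; last by rewrite -gE // integral_words.
rewrite lee_fin; apply: (cvgr_to_le cv); apply: nearW => k.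
have E := gE _ _ hs (mu_ k) mhs; rewrite E -lee_fin fineK ?le_e //.
by rewrite -E integral_words //; exact: mhs.
Qed.

Hypothesis mu_tight : forall e : R, 0 < e -> exists m : rat, forall k i,
  (mu_ k [set x | (x 0 i < - ratr m)%R \/ (ratr m <= x 0 i)%R] <= e%:E)%E.

(** A word realized by no point has an empty cell, hence limit probability 0, and there are
    countably many words. *)
Lemma ae_consistent : {ae P, forall u, consistent (d := d) (R := R) bit u}.
Proof.
pose F n := if (unpickle n : option (seq bool)) is Some w
    then if pselect (cell hs w = set0) then cell bit w else set0 else set0.
have neg : P.-negligible (\bigcup_n F n).
  apply: negligible_bigcup => n; rewrite /F;
  case: (unpickle n) => [w|]; last exact: negligible_set0.
  case: pselect => /= w0; last exact: negligible_set0.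
  apply/negligibleP; first exact: measurable_cell.
  transitivity ((alpha w)%:E); first exact: Pcell.
  congr _%:E.
  have := @mu_cvg w; rewrite w0 => /cvg_lim <- //.
  by under eq_fun do rewrite measure0; rewrite lim_cst.
apply: negligibleS neg => u /= ncu.
have [n nx] : exists n, ~ exists x, word hs n x = word bit n u by exact/existsNP.
exists (pickle (word bit n u)) => //; rewrite /F pickleK; case: pselect => [?|] //=.
  exact: cell_word.
case; apply/seteqP; split => // x; rewrite /cell /= size_word => xu.
by apply: nx; exists x.
Qed.

(** If all the bits of a coordinate agree, the one at a far rational announces a tail, and tails are
    small uniformly in [k]. *)
Lemma ae_bounded_bits : {ae P, forall u, bounded_bits (d := d) bit u}.
Proof.
pose halfline c (i : 'I_d) := \bigcap_(q in [set: rat]) [set u | bit (pickle (i, q)) u = c].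
have mb c n : measurable [set u | bit n u = c].
  case: c; first exact: mbit.
  rewrite (_ : [set u | _] = ~` [set u | bit n u]); first by apply: measurableC; exact: mbit.
  by apply/seteqP; split => u /=; [move=> ->|move=> /negP/negbTE].
have mhalf c i : measurable (halfline c i).
  rewrite -[X in measurable X]setCK setC_bigcap; apply: measurableC.
  apply: countable_bigcupT_measurable => [|q]; first exact: countableP.
  by apply: measurableC; exact: mb.
have null c (i : 'I_d) : P.-negligible (halfline c i).
  apply/negligibleP.
    exact: mhalf.
  apply/eqP; rewrite eq_le measure_ge0 andbT.
  apply/lee_addgt0Pr => e e0; rewrite add0e.
  have [m mP] := mu_tight e0.
  (* Bits all [true] announce a coordinate below [- m], bits all [false] one at or above [m]. *)
  pose p := if c then - m else m.
  apply: (@le_trans _ _ (P [set u | bit (pickle (i, p)) u = c])).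
    apply: le_measure; rewrite ?inE//.
    by move=> u; apply.
  apply: random_bit_le => k; apply: le_trans (mP k i).
  apply: le_measure; rewrite ?inE.
  - rewrite (_ : [set x | _] =
      [set x | (fun w => head false w = c) (word hs (pickle (i, p)).+1 x)]) //.
    exact: (measurable_word_preimage mhs _.+1 (fun w => head false w = c)).
  - rewrite [X in measurable X](_ : _ =
      (fun x : 'rV[R]_d => x 0 i) @^-1` (~` `[- ratr m, ratr m[%classic)).
      rewrite -[X in measurable X]setTI; apply: measurable_mx_coord => //.
      exact: measurableC.
    apply/seteqP; split => x /=; rewrite in_itv /=.
      by move=> [xm|mx]; apply/negP; rewrite negb_and -!ltNge -leNgt ?xm ?mx ?orbT.
    by move=> /negP; rewrite negb_and -ltNge -leNgt => /orP[]; [left|right].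
  - move=> x /=; rewrite halfspaceE /p; case: (c) => [|/negbT].
      by rewrite rmorphN /=; left.
    by rewrite -leNgt; right.
pose F n := if (insub n : option 'I_d) is Some i
    then halfline true i `|` halfline false i else set0.
have : P.-negligible (\bigcup_n F n).
  apply: negligible_bigcup => n; rewrite /F; case: insubP => [i _ _|_]; last exact: negligible_set0.
  by apply: negligibleU; exact: null.
apply: negligibleS => u /= nb.
move: nb; rewrite /bounded_bits => /existsNP[i ni].
exists (i : nat) => //; rewrite /F valK.
have [[p bp]|np] := pselect (exists p : rat, ~~ bit (pickle (i, p)) u).
  right => q _ /=; apply/negbTE/negP => bq; apply: ni; exists p, q; split => //.
left => q _ /=; apply/negPn/negP => bq; apply: np; exists q => //.
Qed.

Definition limit_point (u : measurableTypeR R) : 'rV[R]_d := decode (bit ^~ u).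

Lemma measurable_limit_point : measurable_fun setT limit_point.
Proof. exact: measurable_decode. Qed.

(* A Fatou argument along the refining cells: the infima of G over pairs of
   cells are bounded by G, involve finitely many cells, and increase to G. *)
Lemma limit_law_lsc (G : 'rV[R]_d * 'rV[R]_d -> R) (c : R) :
  continuous G -> (forall z, 0 <= G z) ->
  (c%:E < \int[P \x P]_z (G (limit_point z.1, limit_point z.2))%:E)%E ->
  \forall k \near \oo, (c%:E < \int[mu_ k \x mu_ k]_z (G z)%:E)%E.
Proof.
move=> cG G0 cint.
have mG := continuous_measurable_rV2 cG.
(* The infimum of the empty set is 0, so [g] is nonnegative also on words realized by no point. *)
pose g (v w : seq bool) := inf [set G z | z in cell hs v `*` cell hs w].
have lbG v w : lbound [set G z | z in cell hs v `*` cell hs w] 0.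
  by move=> _ [z _ <-]; exact: G0.
have g0 v w : 0 <= g v w.
  rewrite /g; have [->|/set0P ne] := eqVneq [set G z | z in cell hs v `*` cell hs w] set0.
    by rewrite inf0.
  exact: lb_le_inf.
have gP n z : g (word hs n z.1) (word hs n z.2) <= G z.
  apply: ge_inf; first by exists 0; exact: lbG.
  by exists z => //; split; exact: cell_word.
have mword d' (T : measurableType d') (b : nat -> T -> bool) n :
    (forall n, measurable [set x | b n x]) ->
    measurable_fun setT (fun z : T * T => (g (word b n z.1) (word b n z.2))%:E).
  move=> mb; apply/measurable_EFinP => _ Y mY; rewrite setTI.
  rewrite (_ : _ @^-1` _ = \bigcup_v \bigcup_w (if pselect (Y (g v w)) then
      [set x | word b n x = v] `*` [set x | word b n x = w] else set0)).
    apply: countable_bigcupT_measurable => [|v]; first exact: countableP.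
    apply: countable_bigcupT_measurable => [|w]; first exact: countableP.
    case: pselect => //= ?; apply: measurableX.
      exact: (measurable_word_preimage mb n (fun w => w = v)).
    exact: (measurable_word_preimage mb n (fun v => v = w)).
  apply/seteqP; split => z /=.
    by move=> Yz; exists (word b n z.1) => //; exists (word b n z.2) => //; case: pselect.
  by move=> [v _ [w _]]; case: pselect => // Yvw [/= -> ->].
(* Fatou's lemma over the word length provides one length at which the lower approximation already
   exceeds [c]. *)
have [n cn] : exists n,
    (c%:E < \int[P \x P]_z (g (word bit n z.1) (word bit n z.2))%:E)%E.
  apply: lt_limn_einf; apply: lt_le_trans cint _.
  apply: (@le_trans _ _ (\int[P \x P]_z
      limn_einf (fun n => (g (word bit n z.1) (word bit n z.2))%:E))%E); last first.
    by apply: fatou => // [n|n z _]; [exact: mword|rewrite lee_fin].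
  apply: ae_ge0_le_integral => //.
  - by move=> z _; rewrite lee_fin.
  - apply/measurable_EFinP; apply: (measurableT_comp mG); apply: measurable_fun_pair.
      exact: measurableT_comp measurable_limit_point measurable_fst.
    exact: measurableT_comp measurable_limit_point measurable_snd.
  - move=> z _; apply: le_limn_einf_near; apply: nearW => n; rewrite lee_fin //.
  - rewrite /limn_einf; apply: measurableT_comp => //.
    by apply: measurable_fun_limn_esup => n; apply: measurableT_comp => //; exact: mword.
  have good : {ae P, forall u, consistent (d := d) (R := R) bit u /\
      bounded_bits (d := d) bit u}.
    by move: ae_consistent ae_bounded_bits; apply: filterS2 => u; split.
  have : {ae (P \x P)%E, forall z, (consistent (d := d) (R := R) bit z.1 /\
      bounded_bits (d := d) bit z.1) /\ (consistent (d := d) (R := R) bit z.2 /\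
      bounded_bits (d := d) bit z.2)}.
    apply: negligibleS (negligibleU (negligible_fst P good) (negligible_snd P good)).
    by move=> z /= /not_andP.
  apply: filterS => z [[c1 b1] [c2 b2]] _.
  (* By [nbhs_decode], the cells of long words lie in a neighbourhood where [G] exceeds its value at
     the decoded pair minus [e]; their infimum is then at least that. *)
  apply/lee_subgt0Pr => e e0; apply: le_limn_einf_near.
  have : \forall x \near (limit_point z.1, limit_point z.2),
      G (limit_point z.1, limit_point z.2) - e < G x.
    by apply: (cvgr_gt _ (cG (limit_point z.1, limit_point z.2))); rewrite ltrBlDr ltrDl.
  move=> [[U V] /= [nU nV] UV].
  have nearU := nbhs_decode c1 b1 nU; have nearV := nbhs_decode c2 b2 nV.
  near=> n; rewrite -EFinB lee_fin; apply: lb_le_inf.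
    have [x xz] := c1 n; have [y yz] := c2 n.
    exists (G (x, y)), (x, y) => //; split => /=; rewrite -?xz -?yz; exact: cell_word.
  move=> _ [[x y] [/= + + <-]]; rewrite /cell /= !size_word => xz yz.
  apply/ltW/UV; split => /=.
  - by move: x xz {yz}; near: n.
  - by move: y yz {xz}; near: n.
(* For this fixed [n] the integrals of [g] converge, and [g] lies below [G]. *)
have /cvgr_gt := @integral_words_cvg n g g0; move=> /(_ c).
rewrite -[X in (_ < X)%E]fineK in cn; last by rewrite integral_words.
rewrite -lte_fin; move=> /(_ cn); apply: filterS => k ck.
apply: (@lt_le_trans _ _ (\int[mu_ k \x mu_ k]_z (g (word hs n z.1) (word hs n z.2))%:E)%E).
  by rewrite -[X in (_ < X)%E]fineK ?lte_fin // integral_words //; exact: mhs.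
apply: ge0_le_integral => //.
- by move=> z _; rewrite lee_fin.
- by apply: mword; exact: mhs.
- exact/measurable_EFinP.
- by move=> z _; rewrite lee_fin.
Unshelve. all: by end_near. Qed.

End limit_law.

(* Applied to C + eps * (V x + V y) +- F, this lower semicontinuity yields the
   convergence of the double integrals of F. *)
Lemma prokhorov {R : realType} {d : nat} (mu_ : nat -> probability 'rV[R]_d R) :
  (forall e : R, 0 < e -> exists m : rat, forall k i,
    (mu_ k [set x | (x 0 i < - ratr m)%R \/ (ratr m <= x 0 i)%R] <= e%:E)%E) ->
  exists (n_ : nat -> nat) (mu : probability 'rV[R]_d R), (forall k, (k <= n_ k)%N) /\
    forall (G : 'rV[R]_d * 'rV[R]_d -> R) (c : R),
      continuous G -> (forall z, 0 <= G z) ->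
      (c%:E < \int[mu \x mu]_z (G z)%:E)%E ->
      \forall k \near \oo, (c%:E < \int[mu_ (n_ k) \x mu_ (n_ k)]_z (G z)%:E)%E.
Proof.
move=> tight.
have mcell w := measurable_cell (@measurable_halfspace R d) w.
have [k w|n_ [alpha [n_k cv]]] := @pointwise_subsequence R (seq bool)
    (fun k w => fine (mu_ k (cell (@halfspace R d) w))).
  by rewrite fine_ge0 //= -lee_fin fineK ?fin_num_measure ?probability_le1.
have [mu muE] := pushforward_prod (uniform_prob (@ltr01 R)) (measurable_limit_point (d := d) alpha).
exists n_, mu; split => // G c cG G0; rewrite muE.
- apply: (@limit_law_lsc _ _ (mu_ \o n_) alpha) => //.
  by move=> e e0; have [m mP] := tight e e0; exists m => k i; exact: mP.
- apply/measurable_EFinP; exact: continuous_measurable_rV2.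
- by move=> z; rewrite lee_fin.
Qed.

(** * Double integrals and moments *)

Lemma integral_cst_probability {R : realType} d (T : measurableType d)
  (Q : probability T R) (c : \bar R) : (\int[Q]_x c = c)%E.
Proof.
transitivity (c * Q setT)%E; first exact: integral_cst.
by rewrite probability_setT mule1.
Qed.

Section double_integrals.
Context {R : realType} {n : nat}.
Local Notation E := 'rV[R]_n.
Implicit Type Q : probability E R.

Lemma prod_setT Q : (Q \x Q)%E setT = 1%E.
Proof.
rewrite -setXTT; transitivity (Q setT * Q setT)%E; first exact: product_measure1E.
by rewrite probability_setT mule1.
Qed.

Lemma integral_cst_prod Q (c : \bar R) : (\int[Q \x Q]_z c = c)%E.
Proof.
transitivity (c * (Q \x Q)%E setT)%E; first exact: integral_cst.
by rewrite prod_setT mule1.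
Qed.

Variables (V : E -> R).
Hypothesis mV : measurable_fun setT V.
Hypothesis V0 : forall x, 0 <= V x.

Lemma integral_fst Q :
  (\int[Q \x Q]_z (V z.1)%:E = \int[Q]_x (V x)%:E)%E.
Proof.
rewrite fubini_tonelli1 /=; first last.
- by move=> x; rewrite lee_fin.
- by apply/measurable_EFinP; exact: measurableT_comp measurable_fst.
apply: eq_integral => x _; rewrite /fubini_F /=; exact: integral_cst_probability.
Qed.

Lemma integral_snd Q :
  (\int[Q \x Q]_z (V z.2)%:E = \int[Q]_x (V x)%:E)%E.
Proof.
rewrite fubini_tonelli1 /=; first last.
- by move=> x; rewrite lee_fin.
- by apply/measurable_EFinP; exact: measurableT_comp measurable_snd.
rewrite /fubini_F /=; exact: integral_cst_probability.
Qed.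

Lemma integrable_moment Q : (\int[Q]_x (V x)%:E < +oo)%E ->
  Q.-integrable setT (EFin \o V).
Proof.
move=> V_lty; apply/integrableP; split; first exact/measurable_EFinP.
by under eq_integral do rewrite /= ger0_norm //.
Qed.

Lemma integrable_fst Q : (\int[Q]_x (V x)%:E < +oo)%E ->
  (Q \x Q)%E.-integrable setT (fun z : E * E => (V z.1)%:E).
Proof.
move=> V_lty; apply/integrableP; split.
  by apply/measurable_EFinP; exact: measurableT_comp measurable_fst.
under eq_integral do rewrite /= ger0_norm //.
by rewrite integral_fst.
Qed.

Lemma integrable_snd Q : (\int[Q]_x (V x)%:E < +oo)%E ->
  (Q \x Q)%E.-integrable setT (fun z : E * E => (V z.2)%:E).
Proof.
move=> V_lty; apply/integrableP; split.
  by apply/measurable_EFinP; exact: measurableT_comp measurable_snd.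
under eq_integral do rewrite /= ger0_norm //.
by rewrite integral_snd.
Qed.

(** Additive form of being negligible with respect to [V z.1 + V z.2] where this is large: any
    positive slope is allowed at the price of a constant. *)
Definition subordinate2 (F : E * E -> R) :=
  forall e : R, 0 < e -> exists C, forall z, `|F z| <= C + e * (V z.1 + V z.2).

Lemma integrable_majorant Q (C e : R) : (\int[Q]_x (V x)%:E < +oo)%E ->
  (Q \x Q)%E.-integrable setT (fun z : E * E => (C + e * (V z.1 + V z.2))%:E).
Proof.
move=> V_lty.
have iC : (Q \x Q)%E.-integrable setT (fun z : E * E => C%:E).
  apply/integrableP; split; first exact: measurable_cst.
  by rewrite /= integral_cst_prod ltry.
have := integrableD measurableT iC (integrableZl measurableT e
  (integrableD measurableT (integrable_fst V_lty) (integrable_snd V_lty))).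
by apply: eq_integrable => // z _ /=.
Qed.

Lemma integrable_subordinate2 Q (F : E * E -> R) :
  (\int[Q]_x (V x)%:E < +oo)%E -> measurable_fun setT F -> subordinate2 F ->
  (Q \x Q)%E.-integrable setT (EFin \o F).
Proof.
move=> V_lty mF /(_ 1 ltr01)[C FC].
apply: le_integrable (integrable_majorant C 1 V_lty) => //.
  exact/measurable_EFinP.
by move=> z _ /=; rewrite lee_fin; apply: le_trans (FC z) (ler_norm _).
Qed.

Lemma Rintegral_fst Q (f : E -> R) : Q.-integrable setT (EFin \o f) ->
  (Q \x Q)%E.-integrable setT (fun z => (f z.1)%:E) ->
  \int[(Q \x Q)%E]_z f z.1 = \int[Q]_x f x.
Proof.
move=> fi fi2; rewrite /Rintegral -(integral12_prod_meas1 fi2) /fubini_F /=.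
congr fine; apply: eq_integral => x _.
exact: integral_cst_probability.
Qed.

(** With [s] equal to 1 or -1, this evaluates the nonnegative functions to which lower
    semicontinuity is applied. *)
Lemma Rintegral_majorant Q (C e s : R) (F : E * E -> R) :
  (\int[Q]_x (V x)%:E < +oo)%E -> (Q \x Q)%E.-integrable setT (EFin \o F) ->
  (\int[Q \x Q]_z ((C + e * (V z.1 + V z.2)) + s * F z)%:E =
   (C + e * (2 * \int[Q]_x V x) + s * \int[(Q \x Q)%E]_z F z)%:E)%E.
Proof.
move=> V_lty Fi.
have iC : (Q \x Q)%E.-integrable setT (fun z : E * E => C%:E).
  apply/integrableP; split; first exact: measurable_cst.
  by rewrite /= integral_cst_prod ltry.
have i1 := integrable_fst V_lty; have i2 := integrable_snd V_lty.
have i12 := integrableD measurableT i1 i2.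
have [v vE] : exists v, (\int[Q]_x (V x)%:E = v%:E)%E.
  exists (\int[Q]_x V x); rewrite fineK //.
  exact: integrable_fin_num (integrable_moment V_lty).
have [w wE] : exists w, (\int[Q \x Q]_z (F z)%:E = w%:E)%E.
  exists (\int[(Q \x Q)%E]_z F z); rewrite fineK //.
  exact: integrable_fin_num Fi.
under eq_integral do rewrite EFinD (EFinM s).
rewrite integralD //; [|exact: integrable_majorant|exact: integrableZl].
rewrite integralZl //.
under eq_integral do rewrite EFinD EFinM EFinD.
rewrite integralD //; last exact: integrableZl.
rewrite integralZl // integralD // integral_cst_prod.
rewrite integral_fst integral_snd /Rintegral /=.
rewrite vE wE /=; have -> : C + e * (2 * v) + s * w = C + e * (v + v) + s * w by ring.
by [].
Qed.

End double_integrals.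

(** * Convergence of integrals under a uniform moment bound *)

Section moment_convergence.
Context {R : realType} {n : nat}.
Local Notation E := 'rV[R]_n.
Variables (V : E -> R) (nu_ : nat -> probability E R) (nu : probability E R) (B : R).
Hypothesis cV : continuous V.
Hypothesis V0 : forall x, 0 <= V x.
Hypothesis V_B : forall k, (\int[nu_ k]_x (V x)%:E <= B%:E)%E.
Hypothesis nu_lsc : forall (G : E * E -> R) (c : R),
  continuous G -> (forall z, 0 <= G z) -> (c%:E < \int[nu \x nu]_z (G z)%:E)%E ->
  \forall k \near \oo, (c%:E < \int[nu_ k \x nu_ k]_z (G z)%:E)%E.

Let mV : measurable_fun setT V := continuous_measurable_rV cV.

Let V_lty k : (\int[nu_ k]_x (V x)%:E < +oo)%E.
Proof. exact: le_lt_trans (V_B k) (ltry _). Qed.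

Let cV1 : continuous (fun z : E * E => V z.1).
Proof. by move=> z; apply: continuous_comp; [exact: cvg_fst|exact: cV]. Qed.

Let cV2 : continuous (fun z : E * E => V z.2).
Proof. by move=> z; apply: continuous_comp; [exact: cvg_snd|exact: cV]. Qed.

(** If the limit moment exceeded [B], lower semicontinuity for [V z.1] would make the moments along
    the sequence exceed it too. *)
Lemma moment_limit : (\int[nu]_x (V x)%:E <= B%:E)%E.
Proof.
rewrite leNgt -(integral_fst mV V0); apply/negP => Blt.
have [k _ kB] := nu_lsc cV1 (fun z => V0 z.1) Blt.
have := kB k (leqnn k); rewrite (integral_fst mV V0).
by rewrite ltNge V_B.
Qed.

Let V_nu : (\int[nu]_x (V x)%:E < +oo)%E.
Proof. exact: le_lt_trans moment_limit (ltry _). Qed.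

Lemma double_integral_cvg (F : E * E -> R) : continuous F -> subordinate2 V F ->
  \int[(nu_ k \x nu_ k)%E]_z F z @[k --> \oo] --> \int[(nu \x nu)%E]_z F z.
Proof.
move=> cF FV.
have arith (C eps m mk I Ik e : R) :
    C + eps * (2 * m) + I - e / 2 < C + eps * (2 * mk) + Ik -> 0 < eps ->
    0 <= m -> mk <= B -> e = 4 * (eps * (B + 1)) -> I - e < Ik.
  move=> h eps0 m0 mkB eE.
  have : eps * mk <= eps * B by rewrite ler_pM2l.
  have : 0 <= eps * m by rewrite mulr_ge0 // ltW.
  by lra.
have mF := continuous_measurable_rV2 cF.
have iF (Q : probability E R) : (\int[Q]_x (V x)%:E < +oo)%E ->
    (Q \x Q)%E.-integrable setT (EFin \o F).
  by move=> V_Q; exact: integrable_subordinate2 FV.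
have Rint_le (Q : probability E R) : (\int[Q]_x (V x)%:E <= B%:E)%E -> 0 <= \int[Q]_x V x <= B.
  move=> VQ; rewrite Rintegral_ge0 //= /Rintegral -lee_fin fineK //.
  by rewrite ge0_fin_numE ?integral_ge0 //;
    [exact: le_lt_trans VQ (ltry _)|move=> x _; rewrite lee_fin].
have B0 : 0 <= B by have /andP[m0 mB] := Rint_le _ moment_limit; exact: le_trans mB.
(* s * F + C + e (V + V) is nonnegative for both signs s, so lower
   semicontinuity bounds the limits of the integrals of F and - F from below *)
have one_side s : `|s| = 1 -> forall e, 0 < e -> \forall k \near \oo,
    s * \int[(nu \x nu)%E]_z F z - e < s * \int[(nu_ k \x nu_ k)%E]_z F z.
  move=> s1 e e0.
  (* With this choice the loss in the moment terms, at most [2 * eps * B], and the slack [e / 2] add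
     up to less than [e]. *)
  pose eps := e / (4 * (B + 1)).
  have B1 : 0 < B + 1 by rewrite ltr_wpDl.
  have eps0 : 0 < eps by rewrite divr_gt0 // mulr_gt0.
  have epsE : e = 4 * (eps * (B + 1)) by rewrite /eps; field; rewrite gt_eqF.
  have [C FC] := FV _ eps0.
  have G0 z : 0 <= C + eps * (V z.1 + V z.2) + s * F z.
    have := FC z; rewrite -[`|F z|]mul1r -s1 -normrM.
    by have := ler_norm (- (s * F z)); rewrite normrN; lra.
  have cG : continuous (fun z : E * E => C + eps * (V z.1 + V z.2) + s * F z).
    move=> z; apply: cvgD; last by apply: cvgMr; exact: cF.
    apply: cvgD; first exact: cvg_cst.
    by apply: cvgMr; apply: cvgD; [exact: cV1|exact: cV2].
  pose c := C + eps * (2 * \int[nu]_x V x) + s * \int[(nu \x nu)%E]_z F z - e / 2.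
  have : (c%:E < \int[nu \x nu]_z (C + eps * (V z.1 + V z.2) + s * F z)%:E)%E.
    by rewrite (Rintegral_majorant mV V0) // ?lte_fin /c ?ltrBlDr ?ltrDl ?divr_gt0 //; exact: iF.
  move=> /(nu_lsc cG G0); apply: filterS => k.
  rewrite (Rintegral_majorant mV V0) //; last exact: iF.
  have /andP[m0 mB] := Rint_le _ moment_limit.
  have /andP[mk0 mkB] := Rint_le _ (V_B k).
  by rewrite lte_fin /c => /arith; apply.
apply/cvgrPdist_lt => e e0.
have := one_side 1 (normr1 _) e e0; have := one_side (-1) (normrN1 _) e e0.
apply: filterS2 => k; rewrite !mulN1r !mul1r => h1 h2.
by rewrite ltr_distl; apply/andP; split; lra.
Qed.

(** [f] is viewed as a function of the first of two variables, and Fubini's theorem brings the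
    double integrals back to single ones. *)
Lemma integral_cvg_subordinate (f : E -> R) : continuous f ->
  subordinate2 V (fun z => f z.1) -> integral_cvg nu_ nu f.
Proof.
move=> cf fV.
have cf1 : continuous (fun z : E * E => f z.1).
  by move=> z; apply: continuous_comp; [exact: cvg_fst|exact: cf].
have mf := continuous_measurable_rV cf.
have fi (Q : probability E R) : (\int[Q]_x (V x)%:E < +oo)%E -> Q.-integrable setT (EFin \o f).
  (* On the diagonal, slope 1 gives [|f x| <= C + 2 * V x]. *)
  move=> V_Q; have [C fC] := fV 1 ltr01.
  have := integrableD measurableT (finite_measure_integrable_cst Q C measurableT)
    (integrableZl measurableT 2 (integrable_moment mV V0 V_Q)).
  apply: le_integrable => //; first exact/measurable_EFinP.
  move=> x _ /=; rewrite lee_fin; apply: le_trans (ler_norm _).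
  by have := fC (x, x) => /=; lra.
have fi2 (Q : probability E R) : (\int[Q]_x (V x)%:E < +oo)%E ->
    (Q \x Q)%E.-integrable setT (fun z => (f z.1)%:E).
  move=> V_Q; apply: (integrable_subordinate2 mV V0 V_Q _ fV).
  exact: continuous_measurable_rV2.
split=> [k||]; [exact: fi|exact: fi|].
rewrite -(Rintegral_fst (fi _ V_nu) (fi2 _ V_nu)).
under eq_fun do rewrite -(Rintegral_fst (fi _ (V_lty _)) (fi2 _ (V_lty _))).
exact: (double_integral_cvg cf1 fV).
Qed.

End moment_convergence.

(** * The interaction kernel *)

Lemma continuous_powR {R : realType} (p x : R) : 0 < x -> {for x, continuous (fun t : R => t `^ p)}.
Proof.
move=> x0; apply/differentiable_continuous/derivable1_diffP.
by apply: derivable_powR; rewrite in_itv /= x0.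
Qed.

Lemma continuous_sum {R : realType} {T : topologicalType} (I : finType) (f : I -> T -> R) :
  (forall i, continuous (f i)) -> continuous (fun x => \sum_i f i x).
Proof.
move=> cf x; apply: (@cvg_big _ _ _ 0) => [|i _]; first exact: add_continuous.
exact: cf.
Qed.

Lemma continuous_norm_powR {R : realType} (q : R) : 0 < q ->
  continuous (fun t : R => `|t| `^ q).
Proof.
move=> q0 t; have [->|t0] := eqVneq t 0; last first.
  have nt0 : 0 < `|t| by rewrite normr_gt0.
  exact: (continuous_comp (@norm_continuous _ R t) (@continuous_powR R q _ nt0)).
(* At 0, the radius that works is [e] to the power [1 / q]. *)
apply/cvgrPdist_lt => e e0; near=> y.
rewrite normr0 powR0 ?gt_eqF // sub0r normrN ger0_norm ?powR_ge0 //.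
rewrite -[X in _ < X](@powRr1 _ e) ?ltW // -[1](@mulVf _ q) ?gt_eqF // powRrM.
apply: gt0_ltr_powR; rewrite ?nnegrE ?powR_ge0 //; near: y.
have := @nbhsx_ballx R R 0 (e `^ q^-1); rewrite powR_gt0 // => /(_ isT).
by apply: filterS => y; rewrite /ball /= sub0r normrN.
Unshelve. all: by end_near. Qed.

Lemma powR_subordinate {R : realType} (p q e : R) : 0 <= p < q -> 0 < e ->
  exists C, 0 <= C /\ forall t, 0 <= t -> t `^ p <= C + e * t `^ q.
Proof.
move=> /andP[p0 pq] e0.
have qp0 : 0 < q - p by rewrite subr_gt0.
(* The threshold solves [e * T^(q - p) = 1]: below it [t^p] is at most [T^p], above it [t^p] is at
   most [e * t^q]. *)
pose T := e `^ (- (q - p)^-1).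
have T0 : 0 < T by rewrite powR_gt0.
exists (T `^ p); split => [|t t0]; first exact: powR_ge0.
have [tT|Tt] := leP t T.
  rewrite -[X in X <= _]addr0 lerD // ?mulr_ge0 ?powR_ge0 ?(ltW e0) //.
  by apply: ge0_ler_powR => //; rewrite nnegrE // ltW.
rewrite -[X in X <= _]add0r lerD ?powR_ge0 //.
have tp : 0 < t by exact: lt_trans Tt.
have -> : t `^ q = t `^ (q - p) * t `^ p.
  by rewrite -powRD ?subrK //; apply/implyP => _; rewrite gt_eqF.
rewrite mulrA ler_peMl ?powR_ge0 //.
have -> : 1 = e * T `^ (q - p).
  by rewrite /T -powRrM mulNr mulVf ?gt_eqF // powRN powRr1 ?ltW // divff // gt_eqF.
rewrite ler_pM2l //; apply: ge0_ler_powR; rewrite ?nnegrE //; exact: ltW.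
Qed.

Lemma powR_le1D {R : realType} (p q t : R) : 0 <= p <= q -> 0 <= t -> t `^ p <= 1 + t `^ q.
Proof.
move=> /andP[p0 pq] t0; have [t1|/ltW t1] := leP t 1.
  rewrite -[X in X <= _]addr0 lerD ?powR_ge0 //.
  have -> : 1 = 1 `^ p :> R by rewrite powR1.
  by apply: ge0_ler_powR; rewrite ?nnegrE.
by rewrite -[X in X <= _]add0r lerD //; exact: ler_powR.
Qed.

Section euclidean_norm.
Context {R : realType} {d : nat}.
Implicit Types x y : 'rV[R]_d.

Lemma dotvv_ge0 x : 0 <= dotv x x.
Proof. by apply: sumr_ge0 => i _; rewrite -expr2 sqr_ge0. Qed.

Lemma enorm_ge0 x : 0 <= enorm x.
Proof. exact: sqrtr_ge0. Qed.

Lemma sqr_enorm x : enorm x ^+ 2 = dotv x x.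
Proof. by rewrite sqr_sqrtr // dotvv_ge0. Qed.

Lemma coord_le_enorm x i : `|x 0 i| <= enorm x.
Proof.
rewrite -sqrtr_sqr ler_sqrt ?dotvv_ge0 // /dotv (bigD1 i) //= -expr2 lerDl.
by apply: sumr_ge0 => j _; rewrite -expr2 sqr_ge0.
Qed.

Lemma enorm_eq0 x : (enorm x == 0) = (x == 0).
Proof.
apply/eqP/eqP => [x0|->].
  apply/rowP => i; rewrite mxE; apply/eqP; rewrite -normr_le0 -x0.
  exact: coord_le_enorm.
by rewrite /enorm /dotv big1 ?sqrtr0 // => i _; rewrite mxE mul0r.
Qed.

Lemma enormN x : enorm (- x) = enorm x.
Proof. by congr Num.sqrt; apply: eq_bigr => i _; rewrite mxE mulrNN. Qed.

(** The squared left side is at most [2 * (dotv x x + dotv y y)], hence at most four times the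
    squared maximum. A maximum passes easily through powers. *)
Lemma enormB_le x y : enorm (x - y) <= 2 * Num.max (enorm x) (enorm y).
Proof.
set m := Num.max _ _.
have m0 : 0 <= m by rewrite le_max enorm_ge0.
rewrite -(@ler_pXn2r _ 2) ?nnegrE ?enorm_ge0 ?mulr_ge0 // sqr_enorm exprMn.
apply: (@le_trans _ _ (2 * (dotv x x + dotv y y))).
  rewrite /dotv -big_split mulr_sumr; apply: ler_sum => i _; rewrite !mxE.
  by have := sqr_ge0 (x 0 i + y 0 i); rewrite /=; nra.
have xm : enorm x ^+ 2 <= m ^+ 2 by rewrite ler_pXn2r ?nnegrE ?enorm_ge0 // le_max lexx.
have ym : enorm y ^+ 2 <= m ^+ 2 by rewrite ler_pXn2r ?nnegrE ?enorm_ge0 // le_max lexx orbT.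
by rewrite -!sqr_enorm; lra.
Qed.

Lemma enormB_powR_le s x y : 0 <= s <= 1 ->
  enorm (x - y) `^ s <= 2 * (enorm x `^ s + enorm y `^ s).
Proof.
move=> /andP[s0 s1]; set m := Num.max (enorm x) (enorm y).
have m0 : 0 <= m by rewrite le_max enorm_ge0.
apply: (@le_trans _ _ ((2 * m) `^ s)).
  by apply: ge0_ler_powR; rewrite ?nnegrE ?enorm_ge0 ?mulr_ge0 ?enormB_le.
rewrite powRM //; apply: ler_pM; rewrite ?powR_ge0 //.
  by apply: ler1_powR => //; rewrite ler1n.
by rewrite /m /Num.max; case: ifP => _; rewrite ?lerDl ?lerDr powR_ge0.
Qed.

Lemma dotv_AMGM (e : R) x y : 0 < e ->
  `|dotv x y| <= e * enorm x ^+ 2 + e^-1 * enorm y ^+ 2.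
Proof.
move=> e0; rewrite !sqr_enorm /dotv !mulr_sumr -big_split.
apply: le_trans (ler_norm_sum _ _ _) _; apply: ler_sum => i _ /=.
have e10 : 0 < e^-1 by rewrite invr_gt0.
have ee : e * e^-1 = 1 by rewrite divff // gt_eqF.
rewrite normrM -[x 0 i * x 0 i]expr2 -[y 0 i * y 0 i]expr2.
rewrite -(real_normK (num_real (x 0 i))) -(real_normK (num_real (y 0 i))).
move: (normr_ge0 (x 0 i)) (normr_ge0 (y 0 i)); set u := `|x 0 i|; set v := `|y 0 i| => u0 v0.
(* As [e * e^-1 = 1], this expands to [e * u^2 + e^-1 * v^2 - u * v], the difference of the two
   sides. *)
suff : 0 <= e^-1 * ((e * u - v) ^+ 2 + e * u * v).
  rewrite (_ : e^-1 * _ = (e * e^-1) * (e * u ^+ 2 + e^-1 * v ^+ 2 - u * v) +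
    (1 - e * e^-1) * e^-1 * v ^+ 2); last by ring.
  by rewrite ee; lra.
by rewrite mulr_ge0 ?addr_ge0 ?sqr_ge0 ?mulr_ge0 // ltW.
Qed.

Lemma continuous_enorm : continuous (fun x : 'rV[R]_d => enorm x).
Proof.
have cdot : continuous (fun x : 'rV[R]_d => dotv x x); last first.
  by move=> x; exact: (continuous_comp (cdot x) (@sqrt_continuous R _)).
apply: continuous_sum => i x.
by apply: continuousM; exact: coord_continuous.
Qed.

Lemma continuous_enorm_powR q : 0 < q -> continuous (fun x : 'rV[R]_d => enorm x `^ q).
Proof.
move=> q0; rewrite (_ : (fun x => _) = (fun t => `|t| `^ q) \o (@enorm R d)).
  by move=> x; apply: continuous_comp; [exact: continuous_enorm|exact: continuous_norm_powR].
by apply/funext => x /=; rewrite ger0_norm ?enorm_ge0.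
Qed.

Lemma measurable_enorm : measurable_fun setT (fun x : 'rV[R]_d => enorm x).
Proof. exact: continuous_measurable_rV continuous_enorm. Qed.

End euclidean_norm.

Section kernel.
Context {R : realType} {d : nat}.
Implicit Types (x y : 'rV[R]_d) (s : R).

(** At the origin the factor [x 0 i] vanishes, so no case distinction remains. *)
Lemma kernelKE s x i : kernelK s x 0 i = (1 + s) * enorm x `^ (s - 1) * x 0 i.
Proof. by rewrite /kernelK; case: eqP => [->|_]; rewrite !mxE ?mulr0. Qed.

Lemma kernelKN s x i : kernelK s (- x) 0 i = - kernelK s x 0 i.
Proof. by rewrite !kernelKE enormN mxE mulrN. Qed.

Lemma kernelK_le s x i : 0 <= s -> `|kernelK s x 0 i| <= (1 + s) * enorm x `^ s.
Proof.
move=> s0; have [->|x0] := eqVneq x 0.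
  by rewrite kernelKE mxE mulr0 normr0 mulr_ge0 ?powR_ge0 // addr_ge0.
have e0 : 0 < enorm x by rewrite lt_def enorm_ge0 enorm_eq0 x0.
have -> : enorm x `^ s = enorm x `^ (s - 1) * enorm x.
  rewrite -[X in _ = _ * X]powRr1 ?enorm_ge0 // -powRD ?subrK //.
  by apply/implyP => _; rewrite gt_eqF.
rewrite kernelKE normrM mulrA ger0_norm ?mulr_ge0 ?powR_ge0 ?addr_ge0 //.
by rewrite ler_wpM2l ?coord_le_enorm // mulr_ge0 ?powR_ge0 ?addr_ge0.
Qed.

Lemma continuous_kernelK s x i : x != 0 ->
  {for x, continuous (fun x => kernelK s x 0 i)}.
Proof.
move=> x0; rewrite (_ : (fun x => _) = fun x => (1 + s) * enorm x `^ (s - 1) * x 0 i); last first.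
  by apply/funext => y; rewrite kernelKE.
have ex0 : 0 < enorm x by rewrite lt_def enorm_ge0 enorm_eq0 x0.
have cp := continuous_comp (@continuous_enorm R d x) (@continuous_powR R (s - 1) _ ex0).
apply: continuousM; last exact: coord_continuous.
exact: (continuousM (@cst_continuous _ _ (1 + s) x) cp).
Qed.

Lemma measurable_kernelK s i : measurable_fun setT (fun x => kernelK s x 0 i).
Proof.
under eq_fun do rewrite kernelKE.
apply: measurable_funM; last exact: measurable_mx_coord.
apply: measurable_funM => //.
exact: (measurableT_comp (@measurable_powR R (s - 1)) measurable_enorm).
Qed.

Lemma measurable_subr : measurable_fun setT (fun z : 'rV[R]_d * 'rV[R]_d => z.1 - z.2).
Proof.
apply: measurable_fun_mx => i j; under eq_fun do rewrite !mxE.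
apply: measurable_funB.
  exact: measurableT_comp (measurable_mx_coord _ _) measurable_fst.
exact: measurableT_comp (measurable_mx_coord _ _) measurable_snd.
Qed.

Lemma continuous_subr : continuous (fun z : 'rV[R]_d * 'rV[R]_d => z.1 - z.2).
Proof. by move=> z; apply: cvgB; [exact: cvg_fst|exact: cvg_snd]. Qed.

(* Continuous also where the kernel is singular, the first factor vanishing
   on the diagonal. *)
Lemma continuous_commutator s (f : 'rV[R]_d -> R) i : 0 <= s -> continuous f ->
  continuous (fun z : 'rV[R]_d * 'rV[R]_d => (f z.1 - f z.2) * kernelK s (z.1 - z.2) 0 i).
Proof.
move=> s0 cf z.
have cf1 : {for z, continuous (fun z : 'rV[R]_d * 'rV[R]_d => f z.1)}.
  by apply: continuous_comp; [exact: cvg_fst|exact: cf].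
have cf2 : {for z, continuous (fun z : 'rV[R]_d * 'rV[R]_d => f z.2)}.
  by apply: continuous_comp; [exact: cvg_snd|exact: cf].
have cf12 : {for z, continuous (fun z : 'rV[R]_d * 'rV[R]_d => f z.1 - f z.2)}.
  exact: (continuousB cf1 cf2).
have [z0|z0] := eqVneq (z.1 - z.2) 0; last first.
  have ck : {for z, continuous (fun z : 'rV[R]_d * 'rV[R]_d => kernelK s (z.1 - z.2) 0 i)}.
    apply: (@continuous_comp _ _ _ (fun z : 'rV[R]_d * 'rV[R]_d => z.1 - z.2)
      (fun x => kernelK s x 0 i)); first exact: continuous_subr.
    exact: continuous_kernelK.
  exact: (continuousM cf12 ck).
rewrite /continuous_at z0 kernelKE !mxE !mulr0.
have f0 : f z.1 - f z.2 = 0 by move/eqP: z0; rewrite subr_eq0 => /eqP ->; rewrite subrr.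
apply/cvgrPdist_lt => e e0.
have s1 : 0 < 1 + s by rewrite ltr_wpDr.
have : \forall w \near z, `|f w.1 - f w.2| < e / (1 + s).
  have := cf12; rewrite /prop_for /continuous_at f0 => /cvgrPdist_lt /(_ (e / (1 + s))).
  rewrite divr_gt0 // => /(_ isT); apply: filterS => w.
  by rewrite sub0r normrN.
have : \forall w \near z, enorm (w.1 - w.2) < 1.
  have : {for z, continuous (fun z : 'rV[R]_d * 'rV[R]_d => enorm (z.1 - z.2))}.
    apply: (@continuous_comp _ _ _ (fun z : 'rV[R]_d * 'rV[R]_d => z.1 - z.2)
      (fun x => enorm x)); first exact: continuous_subr.
    exact: continuous_enorm.
  rewrite /prop_for /continuous_at /= z0.
  have -> : enorm (0 : 'rV[R]_d) = 0 by apply/eqP; rewrite enorm_eq0.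
  move=> /cvgrPdist_lt /(_ 1 ltr01); apply: filterS => w.
  by rewrite sub0r normrN ger0_norm ?enorm_ge0.
apply: filterS2 => w w1 fw; rewrite sub0r normrN normrM.
(* Within distance 1 of the diagonal the kernel is bounded, even for [s = 0], so the small first
   factor decides. *)
have Kw : `|kernelK s (w.1 - w.2) 0 i| <= 1 + s.
  apply: le_trans (kernelK_le _ _ s0) _; rewrite ler_piMr ?(ltW s1) //.
  have -> : 1 = 1 `^ s :> R by rewrite powR1.
  by apply: ge0_ler_powR; rewrite ?nnegrE ?enorm_ge0 // ltW.
apply: (@le_lt_trans _ _ (`|f w.1 - f w.2| * (1 + s))); first by rewrite ler_wpM2l.
by rewrite -ltr_pdivlMr.
Qed.

End kernel.

(** * The drift and the symmetrized flux *)

Section attraction_field.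
Context {R : realType} {d : nat}.
Local Notation E := 'rV[R]_d.
Local Notation leb := (@lebesgue_rV R d).

Lemma measurable_set1_rV (x : E) : measurable [set x].
Proof.
rewrite (_ : [set x] = (fun y => enorm (y - x)) @^-1` [set 0]).
  rewrite -[X in measurable X]setTI.
  suff : measurable_fun setT (fun y : E => enorm (y - x)) by apply.
  apply: (measurableT_comp measurable_enorm); apply: measurable_fun_mx => i j.
  under eq_fun do rewrite !mxE.
  by apply: measurable_funB => //; exact: measurable_mx_coord.
apply/seteqP; split => y /=; first by move=> ->; apply/eqP; rewrite enorm_eq0 subrr.
by move=> /eqP; rewrite enorm_eq0 subr_eq0 => /eqP.
Qed.

Lemma lebesgue_rV_set1 (x : E) : (0 < d)%N -> leb [set x] = 0%E.
Proof.
move=> d0; apply/eqP; rewrite eq_le measure_ge0 andbT.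
apply/lee_addgt0Pr => e e0; rewrite add0e.
(* A box of side [h <= 1] has volume [h^d <= h], as [d] is positive, and [h <= e]. *)
pose h := Num.min 1 e.
have h0 : 0 < h by rewrite lt_min ltr01.
have hE i : (const_mx h : E) 0 i = h by rewrite mxE.
pose box := [set y : E | forall i, ((x - const_mx h) 0 i < y 0 i <= x 0 i)%R].
have mbox : measurable box.
  rewrite (_ : box = \bigcap_(i in [set: 'I_d])
      (fun y : E => y 0 i) @^-1` `](x - const_mx h) 0 i, x 0 i]%classic).
    apply: fin_bigcap_measurable; first exact: finite_finset.
    by move=> i _; rewrite -[X in measurable X]setTI; exact: measurable_mx_coord.
  apply/seteqP; split => y /= yP i; first by move=> _ /=; rewrite in_itv /=; exact: yP.
  by have := yP i I; rewrite /= in_itv.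
apply: (@le_trans _ _ (leb box)).
  apply: le_measure; rewrite ?inE //; first exact: measurable_set1_rV.
  by move=> _ -> i; rewrite !mxE lexx andbT ltrBlDr ltrDl.
rewrite lebesgue_rV_box => [|i]; last by rewrite !mxE lerBlDr lerDl ltW.
rewrite (eq_bigr (fun=> h%:E)) => [|i _]; last by rewrite !mxE opprB addrC subrK.
rewrite prodEFin lee_fin prodr_const card_ord.
apply: (@le_trans _ _ (h ^+ 1)).
  by apply: ler_wiXn2l => //; rewrite ?(ltW h0) // ge_min lexx.
by rewrite expr1 ge_min lexx orbT.
Qed.

Lemma measurable_subl (x : E) : measurable_fun setT (fun y : E => x - y).
Proof.
apply: measurable_fun_mx => i j; under eq_fun do rewrite !mxE.
by apply: measurable_funB => //; exact: measurable_mx_coord.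
Qed.

Variables (a q : R) (omega : E -> R).
Hypothesis d_gt0 : (0 < d)%N.
Hypothesis a01 : 0 <= a <= 1.
Hypothesis aq : a <= q.
Hypothesis omega_int : leb.-integrable setT (EFin \o omega).
Hypothesis omega_mom : leb.-integrable setT (fun y => (enorm y `^ q * omega y)%:E).

Let a0 : 0 <= a. Proof. by case/andP: a01. Qed.

(** Dominated convergence along sequences: the integrand converges at every [y] other than [x],
    which is a Lebesgue-null point, and the integrability of [omega] and of its moment provides the
    majorant. *)
Lemma continuous_kernel_conv_density i :
  continuous (fun x => kernel_conv_density a omega x 0 i).
Proof.
under eq_fun do rewrite mxE.
set A := (fun x : E => _).
suff cA (x : E) : A y @[y --> x] --> A x by move=> x; exact: cA.
have momega : measurable_fun setT omega by apply/measurable_EFinP; case/integrableP: omega_int.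
have mf y : measurable_fun setT (fun z : E => (kernelK a (y - z) 0 i * omega z)%:E).
  apply/measurable_EFinP; apply: measurable_funM => //.
  exact: (measurableT_comp (measurable_kernelK a i) (measurable_subl y)).
have seq_cvg (u : nat -> E) : (forall n, ball x n.+1%:R^-1 (u n)) ->
    (forall n, enorm (u n) < enorm x + 1) -> A (u n) @[n --> \oo] --> A x.
  move=> xu ule.
  have ux : u @ \oo --> x.
    apply/cvg_ballP => e e0; near=> n; apply: le_ball (xu n); apply: ltW.
    by near: n; exact: near_infty_natSinv_lt (PosNum e0).
  (* The constants come from [|K_a(u - y)| <= (1 + a) * 2 * (|u|^a + |y|^a)] with
     [|u|^a <= 1 + (|x| + 1)] and [|y|^a <= 1 + |y|^q]. *)
  pose M := (1 + a) * (2 * (1 + (enorm x + 1) + 1)).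
  pose N := (1 + a) * 2.
  have ig : leb.-integrable setT (fun y => (M * `|omega y| + N * `|enorm y `^ q * omega y|)%:E).
    have := integrableD measurableT (integrableZl measurableT M (integrable_norm omega_int))
      (integrableZl measurableT N (integrable_norm omega_mom)).
    by apply: eq_integrable => // y _ /=.
  have [] := @dominated_convergence _ _ _ leb setT measurableT
      (fun n y => (kernelK a (u n - y) 0 i * omega y)%:E)
      (fun y => (kernelK a (x - y) 0 i * omega y)%:E) _ _ _ _ ig _.
  - by move=> n; exact: mf.
  - exact: mf.
  - exists [set x]; split; [exact: measurable_set1_rV|exact: lebesgue_rV_set1|].
    move=> y /= nc; apply: contrapT => yx; apply: nc => _.
    have xy : x - y != 0 by rewrite subr_eq0; apply/eqP => xy; exact: yx.
    apply: cvg_EFin; first exact: nearW.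
    apply: cvgMl; have uy : (u n - y) @[n --> \oo] --> x - y.
      by apply: cvgB; [exact: ux|exact: cvg_cst].
    exact: (cvg_comp _ _ uy (continuous_kernelK xy)).
  - apply/nearW => y n _; rewrite lee_fin normrM.
    have Ky : `|kernelK a (u n - y) 0 i| <= M + N * enorm y `^ q.
      apply: le_trans (kernelK_le _ _ a0) _.
      have ax := enormB_powR_le (u n) y a01.
      have au : enorm (u n) `^ a <= 1 + (enorm x + 1).
        apply: le_trans (powR_le1D a01 (enorm_ge0 _)) _.
        by rewrite powRr1 ?enorm_ge0 // lerD2l ltW.
      have ay : enorm y `^ a <= 1 + enorm y `^ q.
        by apply: powR_le1D; rewrite ?a0 ?enorm_ge0.
      rewrite /M /N -!mulrA -mulrDr ler_wpM2l ?addr_ge0 //.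
      by apply: le_trans ax _; rewrite -mulrDr ler_wpM2l //; lra.
    rewrite (normrM _ (omega y)) (ger0_norm (powR_ge0 _ _)) mulrA -mulrDl.
    by rewrite ler_wpM2r.
  move=> fi _; rewrite /A /Rintegral => cv.
  apply: fine_cvg; rewrite fineK //; exact: integrable_fin_num fi.
(* If continuity failed, bad points in the balls of radius [1 / (n + 1)] would form a sequence
   contradicting [seq_cvg]. *)
apply/(cvgrPdist_lt (FF := nbhs_filter x)) => e e0; apply: contrapT => nA.
have ex n : exists y, [/\ ball x n.+1%:R^-1 y, enorm y < enorm x + 1 & e <= `|A x - A y|].
  apply: contrapT => ny; apply: nA.
  have n0 : (0 : R) < n.+1%:R^-1 by rewrite invr_gt0.
  have ne : \forall y \near x, enorm y < enorm x + 1.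
    by apply: (cvgr_lt _ (@continuous_enorm R d x)); rewrite ltrDl.
  apply: filterS2 (nbhsx_ballx x _ n0) ne => y xy ey.
  by rewrite ltNge; apply/negP => eA; apply: ny; exists y.
have [u uP] := choice ex.
have /cvgrPdist_lt /(_ e e0) := seq_cvg u (fun n => let: And3 h _ _ := uP n in h)
  (fun n => let: And3 _ h _ := uP n in h).
move=> [n _ /(_ n (leqnn n))]; have [_ _ +] := uP n.
by rewrite leNgt => /negP.
Unshelve. all: by end_near. Qed.

End attraction_field.

Section flux.
Context {R : realType} {d : nat}.
Local Notation E := 'rV[R]_d.
Variables (r q : R).
Hypothesis r01 : 0 <= r <= 1.
Hypothesis rq : r < q.

Let r0 : 0 <= r. Proof. by case/andP: r01. Qed.
Let q0 : 0 < q. Proof. exact: le_lt_trans rq. Qed.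
Let V (x : E) := enorm x `^ q.
Let V0 x : 0 <= V x. Proof. exact: powR_ge0. Qed.
Let cV : continuous V := @continuous_enorm_powR R d q q0.
Let mV : measurable_fun setT V := continuous_measurable_rV cV.

Let K i (z : E * E) := kernelK r (z.1 - z.2) 0 i.

Let mK i : measurable_fun setT (K i).
Proof. exact: (measurableT_comp (measurable_kernelK r i) measurable_subr). Qed.

(** The kernel grows at most like the power [r] of each variable, and [r < q]. *)
Lemma kernelK_subordinate (f : E * E -> R) (M : R) i :
  (forall z, `|f z| <= M) -> subordinate2 V (fun z => f z * K i z).
Proof.
move=> fM e e0.
have M0 : 0 <= M by apply: le_trans (fM (0, 0)).
pose N := M * ((1 + r) * 2).
have N0 : 0 <= N by rewrite !mulr_ge0 // addr_ge0.
have N1 : 0 < N + 1 by rewrite ltr_wpDl.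
(* Dividing by [N + 1] covers the case [N = 0]. *)
have [|C [C0 CP]] := @powR_subordinate R r q (e / (N + 1)) _ (divr_gt0 e0 N1).
  by rewrite r0 rq.
exists (N * (C + C)) => z; rewrite normrM.
apply: (@le_trans _ _ (N * (enorm z.1 `^ r + enorm z.2 `^ r))).
  rewrite /N -mulrA; apply: ler_pM => //.
  apply: le_trans (kernelK_le _ _ r0) _; rewrite -mulrA ler_wpM2l ?addr_ge0 //.
  exact: enormB_powR_le.
have h := lerD (CP _ (enorm_ge0 z.1)) (CP _ (enorm_ge0 z.2)).
apply: le_trans (ler_wpM2l N0 h) _.
rewrite addrACA mulrDr lerD2l -mulrDr mulrA ler_wpM2r ?addr_ge0 ?powR_ge0 //.
by rewrite mulrCA ger_pMr // ler_pdivrMr // mul1r lerDl.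
Qed.

Variable Q : probability E R.
Hypothesis V_lty : (\int[Q]_x (V x)%:E < +oo)%E.

Lemma integrable_kernelK i x :
  Q.-integrable setT (fun y => (kernelK r (x - y) 0 i)%:E).
Proof.
have iV := integrable_moment mV V0 V_lty.
pose C := (1 + r) * (2 * (enorm x `^ r + 1)).
have := integrableD measurableT (finite_measure_integrable_cst Q C measurableT)
  (integrableZl measurableT ((1 + r) * 2) iV).
apply: le_integrable => //.
  by apply/measurable_EFinP; exact: (measurableT_comp (measurable_kernelK r i) (measurable_subl x)).
move=> y _ /=; rewrite lee_fin; apply: le_trans (ler_norm _).
apply: le_trans (kernelK_le _ _ r0) _.
have h1 := enormB_powR_le x y r01.
have h2 : enorm y `^ r <= 1 + V y by apply: powR_le1D; rewrite ?enorm_ge0 ?r0 ?ltW.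
rewrite /C -!mulrA -mulrDr ler_wpM2l ?addr_ge0 //.
by apply: le_trans h1 _; rewrite -mulrDr ler_wpM2l //; lra.
Qed.

Variables (f : E -> R) (M : R).
Hypothesis mf : measurable_fun setT f.
Hypothesis fM : forall x, `|f x| <= M.

Let mf1 : measurable_fun setT (fun z : E * E => f z.1).
Proof. exact: measurableT_comp measurable_fst. Qed.

Let mf2 : measurable_fun setT (fun z : E * E => f z.2).
Proof. exact: measurableT_comp measurable_snd. Qed.

Let ik1 i : (Q \x Q)%E.-integrable setT (fun z : E * E => (f z.1 * K i z)%:E).
Proof.
apply: (integrable_subordinate2 mV V0 V_lty); first exact: measurable_funM.
exact: (@kernelK_subordinate (fun z => f z.1) M).
Qed.

Let ik2 i : (Q \x Q)%E.-integrable setT (fun z : E * E => (f z.2 * K i z)%:E).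
Proof.
apply: (integrable_subordinate2 mV V0 V_lty); first exact: measurable_funM.
exact: (@kernelK_subordinate (fun z => f z.2) M).
Qed.

(** Integrability ensures that the real integral in [kernel_conv] is not a default value of
    [fine]. *)
Lemma kernel_convE i x : ((kernel_conv r Q x 0 i)%:E = \int[Q]_y (K i (x, y))%:E)%E.
Proof. by rewrite mxE fineK //; exact: integrable_fin_num (integrable_kernelK i x). Qed.

Let inner i x :
  (\int[Q]_y (f x * K i (x, y))%:E = (f x * kernel_conv r Q x 0 i)%:E)%E.
Proof.
rewrite EFinM kernel_convE; under eq_integral do rewrite EFinM.
by rewrite integralZl //; exact: integrable_kernelK.
Qed.

Lemma integrable_repulsion_flux i :
  Q.-integrable setT (fun x => (f x * kernel_conv r Q x 0 i)%:E).
Proof.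
have := integrable_fubini_F (ik1 i); apply: eq_integrable => // x _.
exact: inner.
Qed.

(* The kernel is odd, so exchanging the two variables symmetrizes the flux. *)
Lemma repulsion_flux_symmetrized i :
  \int[Q]_x (f x * kernel_conv r Q x 0 i) =
  2^-1 * \int[(Q \x Q)%E]_z ((f z.1 - f z.2) * K i z).
Proof.
have intN (g : E -> R) : Q.-integrable setT (EFin \o g) ->
    (\int[Q]_x (- g x)%:E = - \int[Q]_x (g x)%:E)%E.
  move=> ig; under eq_integral do rewrite -mulN1r EFinM.
  by rewrite integralZl // EFinN mulN1e.
have e1 : (\int[Q]_x (f x * kernel_conv r Q x 0 i)%:E =
    \int[Q \x Q]_z (f z.1 * K i z)%:E)%E.
  rewrite -(integral12_prod_meas1 (ik1 i)); apply: eq_integral => x _.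
  by rewrite /fubini_F inner.
(* The other order of integration exchanges the two points, and oddness of the kernel contributes
   the sign. *)
have e2 : (\int[Q]_x (- (f x * kernel_conv r Q x 0 i))%:E =
    \int[Q \x Q]_z (f z.2 * K i z)%:E)%E.
  rewrite -(integral21_prod_meas1 (ik2 i)); apply: eq_integral => x _.
  rewrite /fubini_G EFinN -inner -intN.
    by apply: eq_integral => y _ /=; rewrite /K /= -(opprB x y) kernelKN mulrN.
  have := integrableZl measurableT (f x) (integrable_kernelK i x).
  by apply: eq_integrable => // y _ /=; rewrite EFinM.
have fin := integrable_fin_num measurableT (integrable_repulsion_flux i).
have -> : \int[(Q \x Q)%E]_z ((f z.1 - f z.2) * K i z) =
    \int[(Q \x Q)%E]_z (f z.1 * K i z) - \int[(Q \x Q)%E]_z (f z.2 * K i z).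
  rewrite -(RintegralB measurableT (ik1 i) (ik2 i)).
  by apply: eq_Rintegral => z _; rewrite mulrBl.
rewrite /Rintegral -e1 -e2.
have -> : (\int[Q]_x (- (f x * kernel_conv r Q x 0 i))%:E =
    - \int[Q]_x (f x * kernel_conv r Q x 0 i)%:E)%E.
  by rewrite -intN //; exact: integrable_repulsion_flux.
by rewrite fineN opprK; lra.
Qed.

Lemma measurable_kernel_conv i : measurable_fun setT (fun x => kernel_conv r Q x 0 i).
Proof.
have ik : (Q \x Q)%E.-integrable setT (fun z : E * E => (1 * K i z)%:E).
  apply: (integrable_subordinate2 mV V0 V_lty); first exact: measurable_funM.
  by apply: (@kernelK_subordinate (fun=> 1) 1) => z; rewrite normr1.
apply/measurable_EFinP; have := measurable_fubini_F ik.
apply: eq_measurable_fun => x _ /=; rewrite kernel_convE.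
by apply: eq_integral => y _; rewrite mul1r.
Qed.

End flux.

(** * Vanishing dissipation and passage to the limit *)

(** If the derivative stayed at or below [- e] from [T] on, the mean value theorem over a long
    interval would bring [g] under [m]. *)
Lemma derive1_near_zero {R : realType} (g : R -> R) (m T e : R) :
  (forall t, 0 < t -> derivable g t 1) -> (forall t, 0 < t -> m <= g t) ->
  0 < T -> 0 < e -> exists t, T <= t /\ - e < derive1 g t.
Proof.
move=> dg mg T0 e0; apply: contrapT => no.
have dle t : T <= t -> derive1 g t <= - e.
  by move=> Tt; rewrite leNgt; apply/negP => et; apply: no; exists t.
(* Over this length the drop is at least [e * s = g T - m + e], more than the available
   [g T - m]. *)
pose s := (g T - m) / e + 1.
have s0 : 0 < s by rewrite ltr_wpDl // divr_ge0 ?(ltW e0) // subr_ge0 mg.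
have Ts : T < T + s by rewrite ltrDl.
have [| |c] := @MVT R g (derive1 g) T (T + s) Ts _ _.
- move=> x; rewrite in_itv /= => /andP[Tx _].
  by rewrite derive1E; apply: derivableP; apply: dg; exact: lt_trans Tx.
- apply: derivable_within_continuous => x; rewrite in_itv /= => /andP[Tx _].
  by apply: dg; exact: lt_le_trans Tx.
rewrite in_itv /= => /andP[Tc _]; rewrite addrAC subrr add0r => gE.
have : derive1 g c * s <= - e * s by rewrite ler_wpM2r ?dle // ltW.
have es : e * s = g T - m + e by rewrite /s mulrDr mulr1 mulrC divfK ?gt_eqF.
have := mg (T + s) (addr_gt0 T0 s0).
by rewrite mulNr es; lra.
Qed.

Lemma compact_support_bounded {R : realType} {T : topologicalType} (g : T -> R) (K : set T) :
  continuous g -> compact K -> (forall x, g x != 0 -> K x) ->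
  exists M, forall x, `|g x| <= M.
Proof.
move=> cg cK gK.
have := compact_bounded (continuous_compact (continuous_subspaceT cg) cK).
move=> [M [_ /(_ (M + 1))]]; rewrite ltrDl ltr01 => /(_ isT) gM.
exists (Num.max 0 (M + 1)) => x; have [->|/gK Kx] := eqVneq (g x) 0.
  by rewrite normr0 le_max lexx.
by rewrite le_max; apply/orP; right; apply: gM; exists x.
Qed.

(** Markov's inequality: on a tail [|x|^q] is at least [m^q], and [m] is chosen with
    [B / e <= m^q]. *)
Lemma moment_tight {R : realType} {d : nat} (mu_ : nat -> probability 'rV[R]_d R) (q B : R) :
  0 < q -> (forall k, (\int[mu_ k]_x (enorm x `^ q)%:E <= B%:E)%E) ->
  forall e : R, 0 < e -> exists m : rat, forall k i,
    (mu_ k [set x | (x 0 i < - ratr m)%R \/ (ratr m <= x 0 i)%R] <= e%:E)%E.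
Proof.
move=> q0 mB e e0.
have B0 : 0 <= B.
  rewrite -lee_fin; apply: le_trans (mB 0%N); apply: integral_ge0 => x _.
  by rewrite lee_fin powR_ge0.
have [m m0 mq] : exists2 m : nat, (0 < m)%N & B / e <= m%:R `^ q.
  exists (Num.Def.archi_bound ((B / e) `^ q^-1)).
    rewrite -(ltr_nat R); apply: le_lt_trans (archi_boundP (powR_ge0 _ _)).
    exact: powR_ge0.
  have Be : 0 <= B / e by rewrite divr_ge0 // ltW.
  rewrite [X in X <= _](_ : B / e = ((B / e) `^ q^-1) `^ q); last first.
    by rewrite -powRrM mulVf ?gt_eqF // powRr1.
  apply: ge0_ler_powR; rewrite ?nnegrE ?powR_ge0 ?(ltW q0) //.
  exact/ltW/archi_boundP/powR_ge0.
have mq0 : 0 < m%:R `^ q :> R by rewrite powR_gt0 // ltr0n.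
exists m%:R => k i; rewrite ratr_nat.
pose S := [set x : 'rV[R]_d | (x 0 i < - m%:R)%R \/ (m%:R <= x 0 i)%R].
change (mu_ k S <= e%:E)%E.
have mS : measurable S.
  rewrite [X in measurable X](_ : _ =
    (fun x : 'rV[R]_d => x 0 i) @^-1` (~` `[- m%:R, m%:R[%classic)).
    rewrite -[X in measurable X]setTI; apply: measurable_mx_coord => //.
    exact: measurableC.
  apply/seteqP; split => x /=; rewrite in_itv /=.
    by move=> [xm|mx]; apply/negP; rewrite negb_and -!ltNge -leNgt ?xm ?mx ?orbT.
  by move=> /negP; rewrite negb_and -ltNge -leNgt => /orP[]; [left|right].
have mV : measurable_fun setT (fun x : 'rV[R]_d => enorm x `^ q).
  exact: continuous_measurable_rV (continuous_enorm_powR q0).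
have : (\int[mu_ k]_x (m%:R `^ q * \1_S x)%:E <= B%:E)%E.
  apply: le_trans (mB k); apply: ge0_le_integral => //.
  - by apply/measurable_EFinP; apply: measurable_funM => //; exact: measurable_indic.
  - exact/measurable_EFinP.
  move=> x _; rewrite lee_fin indicE; have [xS|xS] := boolP (x \in S); last first.
    by rewrite mulr0 powR_ge0.
  rewrite mulr1; apply: ge0_ler_powR; rewrite ?nnegrE ?enorm_ge0 ?ler0n ?(ltW q0) //.
  apply: le_trans (coord_le_enorm x i); move: xS; rewrite inE => -[xm|mx].
    by rewrite -normrN; apply: le_trans (ler_norm _); rewrite lerNr ltW.
  exact: le_trans mx (ler_norm _).
under eq_integral do rewrite EFinM.
rewrite ge0_integralZl ?lee_fin ?powR_ge0 //; last first.
  by apply/measurable_EFinP; exact: measurable_indic.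
rewrite integral_indic // setIT -[X in (_ * X)%E]fineK ?fin_num_measure //.
rewrite -EFinM lee_fin => SB.
rewrite -[X in (X <= _)%E]fineK ?fin_num_measure // lee_fin.
rewrite -(ler_pM2l mq0); apply: le_trans SB _.
by rewrite -ler_pdivrMr.
Qed.

(** * The flux against a fixed test field *)

Section test_flux.
Context {R : realType} {d : nat}.
Local Notation E := 'rV[R]_d.
Variables (a r q : R) (omega : E -> R).
Hypothesis r01 : 0 <= r <= 1.
Hypothesis rq : r < q.
Hypothesis cA : forall i, continuous (fun x => kernel_conv_density a omega x 0 i).
Variables (xi : E -> E) (N M : R).
Hypothesis cxi : forall i, continuous (fun x => xi x 0 i).
Hypothesis xiN : forall x, enorm (xi x) ^+ 2 <= N.
Hypothesis xiM : forall i x, `|xi x 0 i| <= M.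
Hypothesis xiA : forall i, exists C : R,
  forall x, `|xi x 0 i * kernel_conv_density a omega x 0 i| <= C.

Let q0 : 0 < q. Proof. by apply: le_lt_trans rq; case/andP: r01. Qed.
Let V (x : E) := enorm x `^ q.
Let cV : continuous V := @continuous_enorm_powR R d q q0.
Let V0 x : 0 <= V x. Proof. exact: powR_ge0. Qed.

Let cxiA i : continuous (fun x => xi x 0 i * kernel_conv_density a omega x 0 i).
Proof. by move=> x; apply: continuousM; [exact: cxi|exact: cA]. Qed.

Lemma bounded_subordinate2 (g : E -> R) : (exists C, forall x, `|g x| <= C) ->
  subordinate2 V (fun z => g z.1).
Proof.
move=> [C gC] e e0; exists C => z; apply: le_trans (gC _) _.
by rewrite lerDl mulr_ge0 ?(ltW e0) // addr_ge0.
Qed.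

Let commutator i (z : E * E) := (xi z.1 0 i - xi z.2 0 i) * kernelK r (z.1 - z.2) 0 i.

Let c_commutator i : continuous (commutator i).
Proof.
have r0 : 0 <= r by case/andP: r01.
exact: (@continuous_commutator R d r (fun x => xi x 0 i) i r0 (@cxi i)).
Qed.

Let sub_commutator i : subordinate2 V (commutator i).
Proof.
apply: (@kernelK_subordinate R d r q r01 rq (fun z => xi z.1 0 i - xi z.2 0 i) (M + M)) => z.
by apply: le_trans (ler_normB _ _) _; rewrite lerD.
Qed.

Let integrand (Q : probability E R) x := dotv (xi x) (drift a r omega Q x).

Let integrandE Q x : integrand Q x =
  \sum_i (xi x 0 i * kernel_conv_density a omega x 0 i - xi x 0 i * kernel_conv r Q x 0 i).
Proof. by apply: eq_bigr => i _; rewrite !mxE mulrBr. Qed.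

Section fixed_measure.
Variable Q : probability E R.
Hypothesis V_lty : (\int[Q]_x (V x)%:E < +oo)%E.

Let iA i : Q.-integrable setT (fun x => (xi x 0 i * kernel_conv_density a omega x 0 i)%:E).
Proof.
have [C xiC] := xiA i.
apply: le_integrable (finite_measure_integrable_cst Q C measurableT) => //.
  apply/measurable_EFinP; exact: continuous_measurable_rV (@cxiA i).
by move=> x _ /=; rewrite lee_fin; apply: le_trans (xiC x) (ler_norm _).
Qed.

Let iC i : Q.-integrable setT (fun x => (xi x 0 i * kernel_conv r Q x 0 i)%:E).
Proof.
exact: (integrable_repulsion_flux r01 rq V_lty (continuous_measurable_rV (@cxi i)) (@xiM i)).
Qed.

Let iAC i : Q.-integrable setT (fun x =>
  (xi x 0 i * kernel_conv_density a omega x 0 i - xi x 0 i * kernel_conv r Q x 0 i)%:E).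
Proof.
by have := integrableB measurableT (iA i) (iC i); apply: eq_integrable => // x _.
Qed.

Lemma integrable_flux : Q.-integrable setT (EFin \o integrand Q).
Proof.
have := integrable_sum measurableT (index_enum 'I_d) (fun i (_ : true) => iAC i).
by apply: eq_integrable => // x _ /=; rewrite integrandE sumEFin.
Qed.

(** Symmetrization leaves only continuous integrands, in one and in two variables, to which the
    convergence results apply. *)
Lemma fluxE : \int[Q]_x integrand Q x =
  \sum_i (\int[Q]_x (xi x 0 i * kernel_conv_density a omega x 0 i) -
          2^-1 * \int[(Q \x Q)%E]_z commutator i z).
Proof.
rewrite /Rintegral (eq_integral (fun x => \sum_i
  (xi x 0 i * kernel_conv_density a omega x 0 i - xi x 0 i * kernel_conv r Q x 0 i)%:E)%E); last first.
  by move=> x _; rewrite integrandE sumEFin.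
rewrite integral_sum //.
rewrite (eq_bigr (fun i => (\int[Q]_x (xi x 0 i * kernel_conv_density a omega x 0 i) -
          2^-1 * \int[(Q \x Q)%E]_z commutator i z)%:E)); first by rewrite sumEFin.
move=> i _; rewrite -(repulsion_flux_symmetrized r01 rq V_lty
  (continuous_measurable_rV (@cxi i)) (@xiM i)).
rewrite -(RintegralB measurableT (iA i) (iC i)) /Rintegral fineK //.
exact: integrable_fin_num (iAC i).
Qed.

(** Weighted AM-GM under the integral: [|xi|^2] contributes at most [N], and the squared drift
    integrates to the dissipation. *)
Lemma flux_le (e D : R) : 0 < e -> dissipation a r omega Q = D%:E ->
  `|\int[Q]_x integrand Q x| <= e * N + e^-1 * D.
Proof.
move=> e0 QD.
have mdrift i : measurable_fun setT (fun x => drift a r omega Q x 0 i).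
  rewrite (_ : (fun x => _) =
      (fun x => kernel_conv_density a omega x 0 i - kernel_conv r Q x 0 i)).
    apply: measurable_funB; first exact: continuous_measurable_rV (@cA i).
    exact: (measurable_kernel_conv r01 rq V_lty).
  by apply/funext => x; rewrite /drift !mxE.
have mdrift2 : measurable_fun setT (fun x => enorm (drift a r omega Q x) ^+ 2).
  under eq_fun do rewrite sqr_enorm /dotv.
  by apply: measurable_sum => i; exact: measurable_funM.
have N0 : 0 <= N by apply: le_trans (xiN 0); exact: sqr_ge0.
have eV0 : 0 <= e^-1 by rewrite invr_ge0 ltW.
rewrite -lee_fin (EFin_normr_Rintegral measurableT integrable_flux).
apply: le_trans (le_abse_integral _ _ _) _ => //; first by case/integrableP: integrable_flux.
apply: (@le_trans _ _ (\int[Q]_x ((e * N)%:E +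
    (e^-1)%:E * (enorm (drift a r omega Q x) ^+ 2)%:E))%E).
  apply: ge0_le_integral => //.
  - by apply: measurableT_comp => //; case/integrableP: integrable_flux.
  - apply: emeasurable_funD => //; apply: measurable_funeM; exact/measurable_EFinP.
  move=> x _; rewrite -EFinM -EFinD lee_fin.
  apply: le_trans (dotv_AMGM _ _ e0) _.
  by rewrite lerD2r ler_wpM2l ?(ltW e0).
rewrite ge0_integralD //.
- rewrite ge0_integralZl ?lee_fin //; last first.
  + by move=> x _; rewrite lee_fin sqr_ge0.
  + exact/measurable_EFinP.
  by rewrite integral_cst_probability -/(dissipation a r omega Q) QD.
- by move=> x _; rewrite lee_fin mulr_ge0 // ltW.
- by move=> x _; rewrite mule_ge0 ?lee_fin ?sqr_ge0.
- apply: measurable_funeM; exact/measurable_EFinP.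
Qed.

End fixed_measure.

Lemma flux_cvg (nu_ : nat -> probability E R) (nu : probability E R) (B : R) :
  (forall k, (\int[nu_ k]_x (V x)%:E <= B%:E)%E) ->
  (forall (G : E * E -> R) (c : R),
    continuous G -> (forall z, 0 <= G z) -> (c%:E < \int[nu \x nu]_z (G z)%:E)%E ->
    \forall k \near \oo, (c%:E < \int[nu_ k \x nu_ k]_z (G z)%:E)%E) ->
  \int[nu_ k]_x integrand (nu_ k) x @[k --> \oo] --> \int[nu]_x integrand nu x.
Proof.
move=> VB lsc.
have V_lty k : (\int[nu_ k]_x (V x)%:E < +oo)%E by exact: le_lt_trans (VB k) (ltry _).
have V_nu : (\int[nu]_x (V x)%:E < +oo)%E.
  exact: le_lt_trans (moment_limit cV V0 VB lsc) (ltry _).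
rewrite (fluxE V_nu); under eq_fun do rewrite (fluxE (V_lty _)).
apply: (@cvg_big _ _ _ 0) => // [|i _]; first exact: add_continuous.
apply: cvgB.
  have [_ _] := integral_cvg_subordinate cV V0 VB lsc (@cxiA i) (bounded_subordinate2 (xiA i)).
  exact.
apply: cvgMr; exact: (double_integral_cvg cV V0 VB lsc (@c_commutator i) (sub_commutator i)).
Qed.

End test_flux.

Lemma test_field_bounds {R : realType} {d : nat} (xi : 'rV[R]_d -> 'rV[R]_d) :
  test_field xi -> exists M : R,
    (forall i x, `|xi x 0 i| <= M) /\ (forall x, enorm (xi x) ^+ 2 <= \sum_(i < d) M * M).
Proof.
move=> [/(_ 0%N) /= cxi cK].
have cxii i : continuous (fun x => xi x 0 i).
  by move=> x; exact: (continuous_comp (cxi x) (@coord_continuous R 1 d 0 i (xi x))).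
have xiK i x : xi x 0 i != 0 -> closure [set x | xi x != 0] x.
  by move=> xi0; apply: subset_closure => /=; apply: contraNneq xi0 => ->; rewrite mxE.
have [M MP] := choice (fun i => compact_support_bounded (@cxii i) cK (@xiK i)).
have le_M i x : `|xi x 0 i| <= \sum_j `|M j|.
  apply: le_trans (MP i x) _; apply: le_trans (ler_norm _) _.
  by rewrite (bigD1 i) //= lerDl; apply: sumr_ge0.
exists (\sum_j `|M j|); split => // x.
rewrite sqr_enorm; apply: ler_sum => i _.
by apply: le_trans (ler_norm _) _; rewrite normrM ler_pM.
Qed.

(** The undefined form [+oo - +oo] evaluates to [-oo], which is not finite. Laws of finite energy
    thus compete in the infimum. *)
Lemma energy_defined_fin_num {R : realType} {d : nat} (a r : R) (omega : 'rV[R]_d -> R)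
    (mu : probability 'rV[R]_d R) :
  energy a r omega mu \is a fin_num -> energy_defined a r omega mu.
Proof.
rewrite /energy /energy_defined.
by case: (attraction _ _ _) => [?||]; case: (repulsion _ _) => [?||].
Qed.

(** [derive1_near_zero] applies to the energy, bounded below by its infimum and with derivative
    minus the dissipation. *)
Lemma vanishing_dissipation {R : realType} {d : nat} (a r : R) (omega : 'rV[R]_d -> R)
    (phi : R -> probability 'rV[R]_d R) :
  energy_dissipation a r omega phi -> (-oo < inf_energy a r omega)%E ->
  forall T e : R, 0 < T -> 0 < e -> exists t D, [/\ T <= t, D < e &
    dissipation a r omega (phi t) = D%:E].
Proof.
move=> edi inf_gt T e T0 e0.
have inf_le t : 0 < t -> (inf_energy a r omega <= energy a r omega (phi t))%E.
  move=> t0; have [fE _ _] := edi t t0.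
  by apply: ereal_inf_lbound; exists (phi t) => //; exact: energy_defined_fin_num.
have fin_inf : inf_energy a r omega \is a fin_num.
  rewrite fin_numElt inf_gt /=; apply: le_lt_trans (inf_le 1 ltr01) _.
  by have [/fin_numPlt/andP[]] := edi 1 ltr01.
have [t||t [Tt et]] := @derive1_near_zero R (fun u => fine (energy a r omega (phi u)))
    (fine (inf_energy a r omega)) T e _ _ T0 e0.
- by move=> t0; have [] := edi t t0.
- by move=> t t0; rewrite fine_le // ?inf_le //; have [] := edi t t0.
have [_ _ tE] := edi t (lt_le_trans T0 Tt).
exists t, (- derive1 (fun u => fine (energy a r omega (phi u))) t); split => //.
  by rewrite ltrNl.
by rewrite EFinN tE oppeK.
Qed.

Theorem theorem8p5 (R : realType) (d : nat) (d_gt0 : (0 < d)%N) (a r : R)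
    (a01 : 0 <= a <= 1) (r01 : 0 <= r <= 1)
    (omega : 'rV[R]_d -> R)
    (omega_ge0 : {ae lebesgue_rV d, forall x, 0 <= omega x})
    (omega_L1 : omega \in Lfun (@lebesgue_rV R d) 1)
    (omega_Loo : omega \in Lfun (@lebesgue_rV R d) +oo)
    (phi : R -> probability 'rV[R]_d R)
    (phi0 : exists2 rho0, has_density (phi 0) rho0 &
      rho0 \in Lfun (@lebesgue_rV R d) +oo)
    (phi_sol : lagrangian_solution a r omega phi)
    (phi_edi : energy_dissipation a r omega phi)
    (inf_gt : (-oo < inf_energy a r omega)%E)
    (q : R) (q_gt : Num.max a r < q)
    (phi_moment : (ereal_sup
      [set \int[phi t]_x (enorm x `^ q)%:E | t in [set t : R | (0 <= t)%R]]
        < +oo)%E)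
    (omega_moment :
      (\int[lebesgue_rV d]_x (enorm x `^ q * omega x)%:E < +oo)%E) :
  exists (t_ : nat -> R) (phioo : probability 'rV[R]_d R),
  [/\ forall k, 0 <= t_ k,
      t_ @ \oo --> +oo,
      narrow_cvg (fun k => phi (t_ k)) phioo,
      zero_flux a r omega phioo &
      forall delta : R, 0 < delta < q ->
      forall f : 'rV[R]_d -> R, continuous f ->
        (exists C : R, forall x, `|f x| <= C * (1 + enorm x `^ (q - delta))) ->
        integral_cvg (fun k => phi (t_ k)) phioo f].
Proof.
have q0 : 0 < q by apply: le_lt_trans q_gt; rewrite le_max; case/andP: a01 => ->.
have aq : a <= q by apply: ltW; apply: le_lt_trans q_gt; rewrite le_max lexx.
have rq : r < q by apply: le_lt_trans q_gt; rewrite le_max lexx orbT.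
pose V (x : 'rV[R]_d) := enorm x `^ q.
have V0 x : 0 <= V x by exact: powR_ge0.
have cV : continuous V by exact: continuous_enorm_powR.
have mV := continuous_measurable_rV cV.
have [B VB] : exists B : R, forall t, 0 <= t -> (\int[phi t]_x (V x)%:E <= B%:E)%E.
  move: phi_moment; set s := ereal_sup _ => s_lty.
  have le_s t : 0 <= t -> (\int[phi t]_x (V x)%:E <= s)%E.
    by move=> t0; apply: ereal_sup_ubound; exists t.
  exists (fine s) => t t0; rewrite fineK ?le_s // ge0_fin_numE //.
  by apply: le_trans (le_s 0 (lexx 0)); apply: integral_ge0 => x _; rewrite lee_fin.
have omega_int : (@lebesgue_rV R d).-integrable setT (EFin \o omega).
  exact/Lfun1_integrable.
have momega : measurable_fun setT omega by apply/measurable_EFinP; case/integrableP: omega_int.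
(* As [omega] is nonnegative almost everywhere, its finite moment is also the integral of the
   absolute value. *)
have omega_mom : (@lebesgue_rV R d).-integrable setT (fun y => (V y * omega y)%:E).
  have mVo : measurable_fun setT (fun y => (V y * omega y)%:E).
    by apply/measurable_EFinP; exact: measurable_funM.
  apply/integrableP; split => //.
  rewrite (ae_eq_integral (fun y => (V y * omega y)%:E)) //.
    exact: measurableT_comp.
  move: omega_ge0; apply: filterS => x x0 _ /=.
  by rewrite ger0_norm // mulr_ge0.
have cA := fun i => continuous_kernel_conv_density d_gt0 a01 aq omega_int omega_mom (i := i).
(* The pair consists of a late time and the small dissipation at that time. *)
have ex k : exists p : R * R, [/\ k.+1%:R <= p.1, p.2 < k.+1%:R^-1 &
    dissipation a r omega (phi p.1) = p.2%:E].
  have k0 : (0 : R) < k.+1%:R^-1 by rewrite invr_gt0.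
  have [t [D [? ? ?]]] := vanishing_dissipation phi_edi inf_gt (ltr0Sn R k) k0.
  by exists (t, D).
have [p pP] := choice ex.
have p_ge k : k.+1%:R <= (p k).1 by have [] := pP k.
have p0 k : 0 <= (p k).1 by apply: le_trans (p_ge k).
have [n_ [nu [n_ge lsc]]] := prokhorov (moment_tight q0 (fun k => VB _ (p0 k))).
have VBn k : (\int[phi (p (n_ k)).1]_x (V x)%:E <= B%:E)%E by exact: VB.
pose nu_ k := phi (p (n_ k)).1.
have cvg_sub := @integral_cvg_subordinate R d V nu_ nu B cV V0 VBn lsc.
exists (fun k => (p (n_ k)).1), nu; split.
- by move=> k; exact: p0.
- apply/cvgryPge => A; near=> k; apply: le_trans (p_ge _).
  apply: (@le_trans _ _ k%:R); last by rewrite ler_nat (leq_trans (n_ge k)).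
  by near: k; exact: nbhs_infty_ger.
- move=> f cf [M [_ /(_ (M + 1))]]; rewrite ltrDl ltr01 => /(_ isT) fM.
  apply: cvg_sub => //; apply: bounded_subordinate2.
  by exists (M + 1) => x; exact: fM.
- move=> xi xi_test; have [M [xiM xiN]] := test_field_bounds xi_test.
  have [/(_ 0%N) /= cxi cK] := xi_test.
  have cxii i : continuous (fun x => xi x 0 i).
    by move=> x; exact: (continuous_comp (cxi x) (@coord_continuous R 1 d 0 i (xi x))).
  have xiA i : exists C : R, forall x, `|xi x 0 i * kernel_conv_density a omega x 0 i| <= C.
    apply: (compact_support_bounded (K := closure [set x | xi x != 0])) => //.
      by move=> x; apply: continuousM; [exact: cxii|exact: cA].
    move=> x xA; apply: subset_closure => /=; apply: contraNneq xA => ->.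
    by rewrite mxE mul0r.
  have V_nu : (\int[nu]_x (V x)%:E < +oo)%E.
    exact: le_lt_trans (moment_limit cV V0 VBn lsc) (ltry _).
  have V_lty k : (\int[nu_ k]_x (V x)%:E < +oo)%E by exact: le_lt_trans (VBn k) (ltry _).
  have J_cvg := flux_cvg r01 rq cA cxii xiM xiA VBn lsc.
  have J_cvg0 : \int[nu_ k]_x dotv (xi x) (drift a r omega (nu_ k) x) @[k --> \oo] --> 0.
    apply/cvgrPdist_lt => e e0.
    pose N := \sum_(i < d) M * M; have N0 : 0 <= N by apply: le_trans (xiN 0); exact: sqr_ge0.
    have N1 : 0 < N + 1 by rewrite ltr_wpDl.
    (* With this AM-GM weight [h * N < e / 2], and the dissipation divided by [h] is below [e / 2]
       once [1 / (k + 1) < e / 2 * h]. *)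
    pose h := e / 2 / (N + 1); have h0 : 0 < h by rewrite !divr_gt0.
    have hN : h * N < e / 2.
      by rewrite /h -mulrA gtr_pMr ?divr_gt0 // mulrC ltr_pdivrMr // mul1r ltrDl.
    near=> k; rewrite sub0r normrN.
    have [_ Dk DE] := pP (n_ k).
    apply: le_lt_trans (flux_le r01 rq cA cxii xiN xiM xiA (V_lty k) h0 DE) _.
    rewrite [ltRHS]splitr ltrD // mulrC ltr_pdivrMr //; apply: lt_trans Dk _.
    apply: (@le_lt_trans _ _ k.+1%:R^-1).
      by rewrite lef_pV2 ?posrE ?ltr0Sn // ler_nat ltnS.
    near: k; apply: (near_infty_natSinv_lt (PosNum (mulr_gt0 (divr_gt0 e0 (ltr0Sn R 1)) h0))).
  have J0 : \int[nu]_x dotv (xi x) (drift a r omega nu x) = 0.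
    exact: cvg_unique J_cvg J_cvg0.
  have iJ := integrable_flux r01 rq cA cxii xiM xiA V_nu.
  (* Integrability turns the vanishing real integral into a vanishing extended one. *)
  by rewrite -[LHS]fineK ?(integrable_fin_num measurableT iJ) //; congr _%:E.
- move=> delta /andP[delta0 deltaq] f cf [C fC]; apply: cvg_sub => //= e e0.
  (* Since [q - delta < q], any slope is available; [e / (|C| + 1)] compensates the factor [C], even
     when it is 0. *)
  have C1 : 0 < `|C| + 1 by rewrite ltr_wpDl.
  have [|K [K0 KP]] := @powR_subordinate R (q - delta) q (e / (`|C| + 1)) _ (divr_gt0 e0 C1).
    by rewrite subr_ge0 (ltW deltaq) ltrBlDr ltrDl.
  exists (`|C| * (1 + K)) => z; apply: le_trans (fC z.1) _.
  apply: (@le_trans _ _ (`|C| * (1 + enorm z.1 `^ (q - delta)))).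
    by rewrite ler_wpM2r ?ler_norm // addr_ge0 ?powR_ge0.
  apply: (@le_trans _ _ (`|C| * (1 + (K + e / (`|C| + 1) * V z.1)))).
    by rewrite ler_wpM2l // lerD2l KP ?enorm_ge0.
  rewrite addrA mulrDr lerD2l mulrA.
  apply: ler_pM; rewrite ?mulr_ge0 ?divr_ge0 ?(ltW e0) ?(ltW C1) //.
    by rewrite mulrCA ger_pMr // ler_pdivrMr // mul1r lerDl.
  by rewrite lerDl.
Unshelve. all: by end_near. Qed.
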